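(* Let $\alpha\in\mathbb{C}$ and let $\beta,\gamma>-1$ be real numbers such that if $\beta,\gamma\in(-1,0)$ then $\beta+\gamma+1\neq 0$. Let $\rho\in\{z\in\mathbb{C}:|z|<1\}$, $x\in[-1,1]$, and put $R:=\sqrt{1+\rho^2-2\rho x}$. Then $$\frac{2^{\alpha+\beta}}{R\,(1+R-\rho)^\alpha(1+R+\rho)^\beta}=\frac{1}{\gamma+\beta+1}\sum_{k=0}^\infty\frac{(2k+\gamma+\beta+1)(\gamma+\beta+1)_k\left(\frac{\alpha+\beta+1}{2}\right)_k\left(\frac{\alpha+\beta+2}{2}\right)_k}{(\alpha+\beta+1)_k\left(\frac{\gamma+\beta+2}{2}\right)_k\left(\frac{\gamma+\beta+3}{2}\right)_k}\;{}_3F_2\!\left(\begin{array}{c}\beta+k+1,\ \alpha+\beta+2k+1,\ \alpha-\gamma\\ \alpha+\beta+k+1,\ \gamma+\beta+2k+2\end{array};\rho\right)\rho^k P_k^{(\gamma,\beta)}(x).$$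
   Context: Square roots and complex powers are principal. $(z)_n:=\prod_{i=1}^n(z+i-1)$ is the Pochhammer symbol. The generalized hypergeometric function is ${}_pF_q(a_1,\dots,a_p;b_1,\dots,b_q;z):=\sum_{n=0}^\infty\frac{(a_1)_n\cdots(a_p)_n}{(b_1)_n\cdots(b_q)_n}\frac{z^n}{n!}$. The Jacobi polynomials are $P_n^{(\alpha,\beta)}(z):=\frac{(\alpha+1)_n}{n!}\,{}_2F_1\left(-n,n+\alpha+\beta+1;\alpha+1;\frac{1-z}{2}\right)$, $n\in\mathbb{N}_0=\{0,1,2,\dots\}$. Interpretation for exceptional $\alpha$: if $\alpha+\beta+1\in\{0,-1,-2,\dots\}$, so that some factors on the right are not individually defined, the product $\frac{\left(\frac{\alpha+\beta+1}{2}\right)_k\left(\frac{\alpha+\beta+2}{2}\right)_k}{(\alpha+\beta+1)_k}\,{}_3F_2(\cdots;\rho)$ is understood as its analytic continuation in $\alpha$, namely $4^{-k}\sum_{n=0}^\infty\frac{(\beta+k+1)_n(\alpha-\gamma)_n(\alpha+\beta+k+n+1)_k}{(\gamma+\beta+2k+2)_n}\frac{\rho^n}{n!}$. *)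

(* Defs.v *)
(* Stdlib reals with Coquelicot's complex numbers [C]. *)
From Stdlib Require Export Reals Factorial List ClassicalEpsilon.
From Coquelicot Require Export Coquelicot.
Export ListNotations.
Open Scope R_scope.
Open Scope C_scope.

Definition Cexp (z : C) : C := RtoC (exp (Re z)) * (cos (Im z), sin (Im z)).

(* Principal argument, with values in (-PI, PI]; the value at 0 is irrelevant. *)
Definition Carg (z : C) : R :=
  if Rle_dec 0 (Im z) then acos (Re z / Cmod z) else (- acos (Re z / Cmod z))%R.

Definition Clog (z : C) : C := (ln (Cmod z), Carg z).

(* Meaningful for a nonzero base only. *)
Definition Cpower (z a : C) : C := Cexp (a * Clog z).

Definition Csqrt (z : C) : C :=
  RtoC (sqrt (Cmod z)) * Cexp (Ci * RtoC (Carg z / 2)).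

Fixpoint poch (z : C) (n : nat) : C :=
  match n with
  | O => 1
  | S m => poch z m * (z + INR m)
  end.

(* A total operator: it is the sum of the series whenever [ex_Cseries u]. *)
Definition Csum (u : nat -> C) : C :=
  (Series (fun n => Re (u n)), Series (fun n => Im (u n))).

Definition ex_Cseries (u : nat -> C) : Prop := @ex_series C_AbsRing C_NormedModule u.

Definition Cprod (l : list C) : C := fold_right Cmult (RtoC 1) l.

Definition pFq_term (a b : list C) (z : C) (n : nat) : C :=
  Cprod (map (fun c => poch c n) a) / Cprod (map (fun c => poch c n) b)
  * (z ^ n / INR (fact n)).

Definition pFq (a b : list C) (z : C) : C := Csum (pFq_term a b z).

Definition Jacobi (n : nat) (alpha beta z : C) : C :=
  poch (alpha + 1) n / INR (fact n)
  * pFq [- INR n; INR n + alpha + beta + 1] [alpha + 1] ((1 - z) / 2).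

Definition exceptional (alpha : C) (beta : R) : Prop :=
  exists m : nat, alpha + beta + 1 = - INR m.

Definition F_upper (alpha : C) (beta gamma : R) (k : nat) : list C :=
  [beta + INR k + 1; alpha + beta + 2 * INR k + 1; alpha - gamma].

Definition F_lower (alpha : C) (beta gamma : R) (k : nat) : list C :=
  [alpha + beta + INR k + 1; gamma + beta + 2 * INR k + 2].

Definition continued_term (alpha : C) (beta gamma : R) (rho : C) (k n : nat) : C :=
  poch (beta + INR k + 1) n * poch (alpha - gamma) n
  * poch (alpha + beta + INR k + INR n + 1) k
  / poch (gamma + beta + 2 * INR k + 2) n
  * (rho ^ n / INR (fact n)).

(* The product of the alpha-dependent Pochhammer quotient and the 3F2; when
   alpha + beta + 1 is a nonpositive integer it denotes the analytic
   continuation in alpha, because some of the factors are then undefined. *)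
Definition coeff (alpha : C) (beta gamma : R) (rho : C) (k : nat) : C :=
  if excluded_middle_informative (exceptional alpha beta) then
    / 4 ^ k * Csum (continued_term alpha beta gamma rho k)
  else
    poch ((alpha + beta + 1) / 2) k * poch ((alpha + beta + 2) / 2) k
    / poch (alpha + beta + 1) k
    * pFq (F_upper alpha beta gamma k) (F_lower alpha beta gamma k) rho.

Definition expansion_term
    (alpha : C) (beta gamma : R) (rho : C) (x : R) (k : nat) : C :=
  (2 * INR k + gamma + beta + 1) * poch (gamma + beta + 1) k
  / (poch ((gamma + beta + 2) / 2) k * poch ((gamma + beta + 3) / 2) k)
  * coeff alpha beta gamma rho k * rho ^ k * Jacobi k gamma beta x.

(* Main.v *)
From Stdlib Require Import Lra Lia.
Require Import Defs.

(** Put [a = alpha], [b = beta], [c = gamma]. The left-hand side is Jacobi's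
    generating function: for |rho| < 1 it is the sum of
    [P_N^(a,b)(x) * rho ^ N]. The right-hand side arises by expanding
    [P_N^(a,b)] in the polynomials [P_k^(c,b)], [k <= N], and by summing over
    [n = N - k] first: up to factors depending on [k] only, the connection
    coefficients are, as functions of [n], the coefficients of the 3F2.

    Generating function ([jac_generating]). With [R = root], [A = 1 + R - rho]
    and [B = 1 + R + rho], the logarithmic derivative of
    [2 ^ (a + b) / (R * A ^ a * B ^ b)] is expressed by [1 / (1 - e rho)],
    [1 / (1 - e' rho)] with [e, e' = exp (+- i theta)], [x = cos theta],
    and by [1 / R], which is itself a function with a simple logarithmic
    derivative. All the coefficients that occur are bounded, so a
    majorant argument ([logder_bound], [logder_sum]) shows that the function is
    the sum of a power series in the whole disc, with coefficients of
    subexponential growth. An algebraic identity between the functions with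
    parameters [(a, b)], [(a + 1, b)] and [(a, b + 1)] ([gen_fun_identity]) says
    that these coefficients satisfy the recurrence
    [(n + 1) P_(n+1)^(a,b) = (n + 1 + a) (1 + x)/2 P_n^(a,b+1)
      - (n + 1 + b) (1 - x)/2 P_n^(a+1,b)],
    which characterizes the Jacobi polynomials ([jac_rec], [jac_unique]). As a
    by-product, Jacobi polynomials grow subexponentially in the degree for
    [-1 <= x <= 1] ([jac_subexp]).

    Connection formula ([jac_connection]). Comparing coefficients of powers of
    [(1 + x) / 2] leaves a terminating well-poised sum, evaluated by a
    Wilf-Zeilberger pair ([wz_pair], [wp_sum]).

    Rearrangement ([is_sum_expansion]). Quotients of Pochhammer symbols of equal
    length grow subexponentially ([rpoch_ratio_subexp]), hence the double series
    is dominated by [K * q ^ (k + n)] with [q < 1] ([double_term_bound]) and may be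
    summed by rows or by antidiagonals ([sum_by_rows_iff]). The form
    [continued_term] of the coefficients never divides by a Pochhammer symbol
    in [a], so exceptional and ordinary [a] are treated together;
    [pFq_term_continued] converts it to the 3F2 in the ordinary case. *)

(** * Finite sums and complex series *)

Notation is_sum := (@is_series C_AbsRing C_NormedModule).

Fixpoint csum (u : nat -> C) (n : nat) : C :=
  match n with
  | O => 0
  | S m => csum u m + u m
  end.

Lemma csum_S u n : csum u (S n) = csum u n + u n.
Proof. reflexivity. Qed.

Lemma sum_n_csum (u : nat -> C) n :
  @sum_n C_AbelianMonoid u n = csum u (S n).
Proof.
induction n as [|n IH].
- rewrite sum_O. simpl. ring.
- rewrite sum_Sn, IH. reflexivity.
Qed.

Lemma csum_ext u v n : (forall k, (k < n)%nat -> u k = v k) -> csum u n = csum v n.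
Proof.
induction n as [|n IH]; simpl; intros H; [reflexivity|].
rewrite IH, (H n) by (try intros; try apply H; lia). reflexivity.
Qed.

Lemma csum_plus u v n : csum (fun k => u k + v k) n = csum u n + csum v n.
Proof. induction n as [|n IH]; simpl; [|rewrite IH]; ring. Qed.

Lemma csum_scal c u n : csum (fun k => c * u k) n = c * csum u n.
Proof. induction n as [|n IH]; simpl; [|rewrite IH]; ring. Qed.

Lemma csum_head u n : csum u (S n) = u O + csum (fun k => u (S k)) n.
Proof. induction n as [|n IH]; simpl in *; [|rewrite IH]; ring. Qed.

Lemma csum_app u m n : csum u (m + n) = csum u m + csum (fun k => u (m + k)%nat) n.
Proof.
induction n as [|n IH]; simpl; [rewrite Nat.add_0_r; ring|].
rewrite Nat.add_succ_r. simpl. rewrite IH. ring.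
Qed.

Lemma csum_zero (u : nat -> C) n : (forall k, (k < n)%nat -> u k = 0) -> csum u n = 0.
Proof.
intros H. rewrite (csum_ext u (fun _ => 0 * 0)), csum_scal; [ring|].
intros. rewrite H by assumption. ring.
Qed.

(** [sum_f_R0 b n] runs over [0..n] inclusive, whence the correction by the
    last term. *)
Lemma Cmod_csum_le u (b : nat -> R) n :
  (forall k, (k < n)%nat -> (Cmod (u k) <= b k)%R) ->
  (Cmod (csum u n) <= sum_f_R0 b n - b n)%R.
Proof.
induction n as [|n IH]; intros H.
- simpl. rewrite Cmod_0. lra.
- simpl. assert (H1 : (Cmod (csum u n) <= sum_f_R0 b n - b n)%R) by (apply IH; intros; apply H; lia).
  pose proof (H n ltac:(lia)). pose proof (Cmod_triangle (csum u n) (u n)). lra.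
Qed.

(** Grouping the lattice points [k + m < N] along antidiagonals or along rows;
    the second grouping cuts the [k]-th row after [N - k] terms. *)
Lemma csum_triangle (d : nat -> nat -> C) N :
  csum (fun M => csum (fun k => d k (M - k)%nat) (S M)) N
  = csum (fun k => csum (d k) (N - k)) N.
Proof.
induction N as [|N IH]; [reflexivity|].
rewrite (csum_S (fun M => _) N), IH, (csum_S (fun k => csum (d k) (S N - k)) N), (csum_S (fun k => d k (N - k)%nat) N), Nat.sub_diag.
replace (S N - N)%nat with 1%nat by lia.
rewrite (csum_ext (fun k => csum (d k) (S N - k))
  (fun k => csum (d k) (N - k) + d k (N - k)%nat)), csum_plus; [simpl; ring|].
intros k Hk. replace (S N - k)%nat with (S (N - k)) by lia. reflexivity.
Qed.

(** Convergence is handled through real sequences tending to 0, where squeezing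
    is available. *)
Lemma is_sum_lim (u : nat -> C) (l : C) :
  is_sum u l <-> is_lim_seq (fun n => Cmod (csum u n - l)) 0%R.
Proof.
rewrite is_lim_seq_incr_1. unfold is_series.
rewrite (filterlim_locally_ball_norm (K:=C_AbsRing) (U:=C_NormedModule)), is_lim_seq_Reals.
split.
- intros H eps Heps. destruct (H (mkposreal eps Heps)) as [N HN].
  exists N. intros n Hn. specialize (HN n Hn). unfold ball_norm in HN.
  rewrite sum_n_csum in HN. unfold R_dist, Rminus. rewrite Ropp_0, Rplus_0_r, Rabs_pos_eq by apply Cmod_ge_0.
  exact HN.
- intros H [eps Heps]. destruct (H eps Heps) as [N HN].
  exists N. intros n Hn. specialize (HN n Hn).
  unfold R_dist, Rminus in HN. rewrite Ropp_0, Rplus_0_r, Rabs_pos_eq in HN by apply Cmod_ge_0.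
  unfold ball_norm. rewrite sum_n_csum. exact HN.
Qed.

Lemma lim0_le (u v : nat -> R) :
  (forall n, (0 <= u n <= v n)%R) -> is_lim_seq v 0%R -> is_lim_seq u 0%R.
Proof.
intros H Hv. apply (is_lim_seq_le_le (fun _ => 0%R) u v); auto. apply is_lim_seq_const.
Qed.

Lemma is_sum_unique (u : nat -> C) (l l' : C) : is_sum u l -> is_sum u l' -> l = l'.
Proof.
rewrite 2!is_sum_lim. intros H H'.
assert (is_lim_seq (fun _ => Cmod (l' - l)) 0%R) as H0.
{ apply (lim0_le _ (fun n => (Cmod (csum u n - l) + Cmod (csum u n - l'))%R)).
  - intros n. split; [apply Cmod_ge_0|].
    replace (l' - l) with ((csum u n - l) + - (csum u n - l')) by ring.
    rewrite <- (Cmod_opp (csum u n - l')). apply Cmod_triangle.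
  - replace (Finite 0) with (Rbar_plus 0%R 0%R) by (simpl; f_equal; ring).
    apply is_lim_seq_plus'; assumption. }
pose proof (is_lim_seq_unique _ _ H0) as E. rewrite Lim_seq_const in E.
injection E as E. apply Cmod_eq_0 in E.
replace l' with (l + (l' - l)) by ring. rewrite E. ring.
Qed.

Lemma is_sum_Re_Im (u : nat -> C) (l : C) :
  is_sum u l -> is_series (fun n => Re (u n)) (Re l) /\ is_series (fun n => Im (u n)) (Im l).
Proof.
rewrite is_sum_lim. intros H.
assert (E : forall (f : C -> R), (forall a b, f (a - b)%C = f a - f b)%R -> f 0 = 0%R ->
  (forall a b, f (a + b)%C = f a + f b)%R -> (forall a, Rabs (f a) <= Cmod a)%R ->
  is_series (fun n => f (u n)) (f l)).
{ intros f fm f0 fp fb.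
  assert (Es : forall n, sum_f_R0 (fun n => f (u n)) n = f (csum u (S n))).
  { induction n as [|n IH]; simpl; [rewrite fp, f0; ring|].
    rewrite IH. simpl. rewrite !fp. ring. }
  apply is_series_Reals. intros eps Heps.
  apply is_lim_seq_Reals in H. destruct (H eps Heps) as [N HN].
  exists N. intros n Hn. rewrite Es. unfold R_dist. rewrite <- fm.
  eapply Rle_lt_trans; [apply fb|].
  specialize (HN (S n) ltac:(lia)).
  unfold R_dist, Rminus in HN. rewrite Ropp_0, Rplus_0_r, Rabs_pos_eq in HN by apply Cmod_ge_0.
  exact HN. }
split; apply E; try reflexivity; intros.
- apply re_le_Cmod.
- apply (Rle_trans _ _ _ (Rmax_r _ _) (Rmax_Cmod a)).
Qed.

Lemma is_sum_Csum (u : nat -> C) (l : C) : is_sum u l -> Csum u = l.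
Proof.
intros H. apply is_sum_Re_Im in H. destruct H as [H1 H2].
unfold Csum. rewrite (is_series_unique _ _ H1), (is_series_unique _ _ H2).
destruct l; reflexivity.
Qed.

Lemma is_sum_ext (u v : nat -> C) (l : C) : (forall n, u n = v n) -> is_sum u l -> is_sum v l.
Proof. apply is_series_ext. Qed.

Lemma is_sum_plus (u v : nat -> C) (l m : C) : is_sum u l -> is_sum v m -> is_sum (fun n => u n + v n) (l + m).
Proof. apply (is_series_plus (V:=C_NormedModule)). Qed.

Lemma is_sum_scal (c : C) (u : nat -> C) (l : C) : is_sum u l -> is_sum (fun n => c * u n) (c * l).
Proof. apply (is_series_scal (V:=C_NormedModule)). Qed.

Lemma is_sum_cons (u : nat -> C) (l : C) : is_sum (fun n => u (S n)) l -> is_sum u (u O + l).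
Proof.
rewrite 2!is_sum_lim. intros H. apply is_lim_seq_incr_1.
eapply is_lim_seq_ext, H. intros n. rewrite csum_head. simpl. f_equal. ring.
Qed.

Lemma is_sum_tail (u : nat -> C) (l : C) m :
  is_sum u l -> is_sum (fun n => u (m + n)%nat) (l - csum u m).
Proof.
rewrite 2!is_sum_lim. intros H. apply (is_lim_seq_incr_n _ m) in H.
eapply is_lim_seq_ext, H. intros n. simpl. rewrite Nat.add_comm, csum_app. f_equal. ring.
Qed.

Lemma is_sum_finite (u : nat -> C) n : (forall k, (n <= k)%nat -> u k = 0) -> is_sum u (csum u n).
Proof.
intros H. apply is_sum_lim, (is_lim_seq_incr_n _ n).
eapply is_lim_seq_ext, is_lim_seq_const. intros k. simpl.
rewrite Nat.add_comm, csum_app, (csum_zero (fun k => u (n + k)%nat)) by (intros; apply H; lia).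
replace (csum u n + 0 - csum u n) with (RtoC 0) by ring. now rewrite Cmod_0.
Qed.

Lemma lim0_geom q : (0 <= q < 1)%R -> is_lim_seq (fun n => q ^ n)%R 0%R.
Proof. intros H. apply is_lim_seq_geom. rewrite Rabs_pos_eq; lra. Qed.

Lemma ex_sum_geom u (K q : R) :
  (0 <= q < 1)%R -> (forall n, Cmod (u n) <= K * q ^ n)%R -> ex_Cseries u.
Proof.
intros Hq H. apply (ex_series_le (V:=C_CompleteNormedModule) u (fun n => K * q ^ n)%R).
- intros n. apply H.
- apply (ex_series_scal (V:=R_NormedModule)), ex_series_geom. rewrite Rabs_pos_eq; lra.
Qed.

Lemma is_sum_of_ex u : ex_Cseries u -> is_sum u (Csum u).
Proof. intros [l H]. rewrite (is_sum_Csum _ _ H). exact H. Qed.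

(** Applied to shifted series, this bounds the tails in [double_diff]. *)
Lemma Cmod_sum_geom (u : nat -> C) (l : C) (K q : R) :
  (0 <= q < 1)%R -> (forall n, Cmod (u n) <= K * q ^ n)%R -> is_sum u l ->
  (Cmod l <= K / (1 - q))%R.
Proof.
intros Hq H Hl. apply is_sum_lim in Hl.
assert (HK : (0 <= K)%R).
{ specialize (H O). pose proof (Cmod_ge_0 (u O)). simpl in H. lra. }
assert (B : forall n, (Cmod (csum u n) <= K / (1 - q))%R).
{ intros n. assert (Cmod (csum u n) <= K * (1 - q ^ n) / (1 - q))%R.
  { induction n as [|n IH]; simpl.
    - rewrite Cmod_0. right. field. lra.
    - eapply Rle_trans; [apply Cmod_triangle|].
      eapply Rle_trans; [apply Rplus_le_compat; [exact IH|apply H]|].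
      right. field. lra. }
  eapply Rle_trans; [exact H0|]. apply Rmult_le_compat_r.
  - left. apply Rinv_0_lt_compat. lra.
  - pose proof (pow_le q n (proj1 Hq)). nra. }
assert (L : is_lim_seq (fun n => K / (1 - q) + Cmod (csum u n - l))%R (K / (1 - q) + 0)%R).
{ apply is_lim_seq_plus'; [apply is_lim_seq_const|exact Hl]. }
rewrite Rplus_0_r in L.
apply (is_lim_seq_le (fun _ => Cmod l) _ (Cmod l) (K / (1 - q))%R) in L; [exact L| |apply is_lim_seq_const].
intros n. specialize (B n).
replace l with (csum u n + - (csum u n - l)) at 1 by ring.
eapply Rle_trans; [apply Cmod_triangle|]. rewrite Cmod_opp. lra.
Qed.

(** With [p] the square root of [q], one factor [p ^ n] absorbs [INR n]: the
    geometric sum [1 + p + ... + p ^ (n - 1)] is at least [n * p ^ n]. *)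
Lemma pow_mul_lim0 q : (0 <= q < 1)%R -> is_lim_seq (fun n => INR n * q ^ n)%R 0%R.
Proof.
intros Hq. set (p := sqrt q).
assert (Hp0 : (0 <= p)%R) by apply sqrt_pos.
assert (Hp2 : (p * p = q)%R) by (apply sqrt_sqrt; lra).
assert (Hp : (p < 1)%R) by nra.
apply (lim0_le _ (fun n => / (1 - p) * p ^ n)%R).
- intros n. pose proof (pos_INR n). pose proof (pow_le q n (proj1 Hq)).
  split; [nra|].
  rewrite <- Hp2, Rpow_mult_distr, <- Rmult_assoc.
  apply Rmult_le_compat_r; [apply pow_le; lra|].
  assert (A : forall n, (INR n * p ^ n <= (1 - p ^ n) / (1 - p))%R).
  { clear -Hp0 Hp. intros n. induction n as [|n IH].
    - simpl. unfold Rdiv. lra.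
    - rewrite S_INR. simpl. assert (0 <= p ^ n)%R by (apply pow_le; lra).
      replace ((1 - p * p ^ n) / (1 - p))%R with ((1 - p ^ n) / (1 - p) + p ^ n)%R by (field; lra).
      pose proof (pos_INR n).
      assert (INR n * (p * p ^ n) <= INR n * p ^ n)%R by (apply Rmult_le_compat_l; nra).
      nra. }
  eapply Rle_trans; [apply A|].
  assert (0 <= p ^ n)%R by (apply pow_le; lra).
  unfold Rdiv. rewrite <- (Rmult_1_l (/ (1 - p))) at 2.
  apply Rmult_le_compat_r; [left; apply Rinv_0_lt_compat|]; lra.
- replace (Finite 0) with (Rbar_mult (/ (1 - p))%R 0%R) by (simpl; f_equal; ring).
  apply is_lim_seq_scal_l, lim0_geom. lra.
Qed.

(** * Double series dominated by a geometric one *)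

Section Double.
Variables (d : nat -> nat -> C) (s : nat -> C) (K q : R).
Hypothesis Hq : (0 <= q < 1)%R.
Hypothesis Hd : forall k n, (Cmod (d k n) <= K * q ^ (k + n))%R.
Hypothesis Hs : forall k, is_sum (d k) (s k).

(** Up to order [N] the sum by rows exceeds the sum by antidiagonals by the [N]
    row tails beyond the antidiagonal, each of them of order [q ^ N]. *)
Lemma double_diff :
  is_lim_seq (fun N => Cmod (csum s N - csum (fun M => csum (fun k => d k (M - k)%nat) (S M)) N)) 0%R.
Proof.
apply (lim0_le _ (fun N => (K / (1 - q)) * (INR N * q ^ N))%R).
- intros N. split; [apply Cmod_ge_0|].
  rewrite csum_triangle.
  replace (csum s N - _) with (csum (fun k => s k + (- (1)) * csum (d k) (N - k)) N)
    by (rewrite csum_plus, csum_scal; ring).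
  eapply Rle_trans; [apply (Cmod_csum_le _ (fun _ => (K / (1 - q)) * q ^ N)%R)|].
  + intros k Hk.
    replace (s k + _) with (s k - csum (d k) (N - k)) by ring.
    replace (K / (1 - q) * q ^ N)%R with (K * q ^ N / (1 - q))%R by (field; lra).
    eapply Cmod_sum_geom; [exact Hq| |apply is_sum_tail, Hs].
    intros n. rewrite Rmult_assoc, <- pow_add.
    replace (N + n)%nat with (k + (N - k + n))%nat by lia. apply Hd.
  + rewrite sum_cte, S_INR. right. ring.
- replace (Finite 0) with (Rbar_mult (K / (1 - q))%R 0%R) by (simpl; f_equal; ring).
  apply is_lim_seq_scal_l, pow_mul_lim0, Hq.
Qed.

(** Both directions are needed: from rows to antidiagonals for the Cauchy
    product, from antidiagonals to rows for the final rearrangement. *)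
Lemma sum_by_rows_iff (l : C) :
  is_sum (fun M => csum (fun k => d k (M - k)%nat) (S M)) l <-> is_sum s l.
Proof.
pose proof double_diff as H.
rewrite 2!is_sum_lim.
set (t := csum (fun M => _)) in *.
split; intros Hl.
- apply (lim0_le _ (fun N => Cmod (csum s N - t N) + Cmod (t N - l))%R).
  + intros N. split; [apply Cmod_ge_0|].
    replace (csum s N - l) with ((csum s N - t N) + (t N - l)) by ring. apply Cmod_triangle.
  + replace (Finite 0) with (Rbar_plus 0%R 0%R) by (simpl; f_equal; ring).
    apply is_lim_seq_plus'; assumption.
- apply (lim0_le _ (fun N => Cmod (csum s N - t N) + Cmod (csum s N - l))%R).
  + intros N. split; [apply Cmod_ge_0|].
    replace (t N - l) with (- (csum s N - t N) + (csum s N - l)) by ring.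
    rewrite <- (Cmod_opp (csum s N - t N)). apply Cmod_triangle.
  + replace (Finite 0) with (Rbar_plus 0%R 0%R) by (simpl; f_equal; ring).
    apply is_lim_seq_plus'; assumption.
Qed.
End Double.

Definition cauchy (a b : nat -> C) (n : nat) : C :=
  csum (fun k => a k * b (n - k)%nat) (S n).

(** The Cauchy product is the antidiagonal sum of [a k * b n], whose row sums
    are the multiples [a k * lb]. *)
Lemma is_sum_cauchy (a b : nat -> C) (la lb : C) (K L q : R) :
  (0 <= q < 1)%R -> (forall n, Cmod (a n) <= K * q ^ n)%R ->
  (forall n, Cmod (b n) <= L * q ^ n)%R ->
  is_sum a la -> is_sum b lb -> is_sum (cauchy a b) (la * lb).
Proof.
intros Hq Ha Hb Hla Hlb.
apply (sum_by_rows_iff (fun k n => a k * b n) (fun k => a k * lb) (K * L) q Hq).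
- intros k n. rewrite Cmod_mult, pow_add.
  replace (K * L * (q ^ k * q ^ n))%R with ((K * q ^ k) * (L * q ^ n))%R by ring.
  apply Rmult_le_compat; auto using Cmod_ge_0.
- intros k. apply is_sum_scal, Hlb.
- rewrite Cmult_comm. apply (is_sum_ext (fun k => lb * a k)).
  + intros k. apply Cmult_comm.
  + apply is_sum_scal, Hla.
Qed.

(** * Jacobi polynomials with arbitrary complex parameters *)

Lemma INR_S_C n : RtoC (INR (S n)) = INR n + 1.
Proof. now rewrite S_INR, RtoC_plus. Qed.

Lemma INR_add_C m n : RtoC (INR (m + n)) = INR m + INR n.
Proof. now rewrite plus_INR, RtoC_plus. Qed.

Lemma INR_S_neq0 n : RtoC (INR n) + 1 <> 0.
Proof. rewrite <- INR_S_C. intros H. apply RtoC_inj in H. revert H. apply not_0_INR. lia. Qed.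

Lemma fact_neq0 n : RtoC (INR (fact n)) <> 0.
Proof. intros H. apply RtoC_inj in H. revert H. apply INR_fact_neq_0. Qed.

Lemma fact_S_C n : RtoC (INR (fact (S n))) = (INR n + 1) * INR (fact n).
Proof. now rewrite fact_simpl, mult_INR, RtoC_mult, INR_S_C. Qed.

Lemma poch_head z n : poch z (S n) = z * poch (z + 1) n.
Proof.
induction n as [|n IH]; [simpl; ring|].
change (poch z (S (S n))) with (poch z (S n) * (z + INR (S n))).
rewrite IH, INR_S_C. simpl. ring.
Qed.

Lemma poch_add z m n : poch z (m + n) = poch z m * poch (z + INR m) n.
Proof.
induction n as [|n IH]; simpl; [rewrite Nat.add_0_r; ring|].
rewrite Nat.add_succ_r. simpl. rewrite IH, INR_add_C. ring.
Qed.

Lemma poch_eq0 n k : (n < k)%nat -> poch (- INR n) k = 0.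
Proof.
intros H. replace k with (S n + (k - S n))%nat by lia. rewrite poch_add. simpl. ring.
Qed.

(** Coefficients of the Jacobi polynomial of degree [n] in powers of
    [- (1 - x) / 2]. The quotient of [poch (a + 1) n] by [poch (a + 1) j] is
    written as a shifted Pochhammer symbol, so that [a] may be a negative
    integer. The value 0 beyond the degree lets sums run over any larger
    range. *)
Definition jac_coef (n : nat) (a b : C) (j : nat) : C :=
  if Nat.leb j n then
    poch (a + INR j + 1) (n - j) * poch (INR n + a + b + 1) j
    / (INR (fact j) * INR (fact (n - j)))
  else 0.

(** The value at [x = 1 - 2 * s] of the Jacobi polynomial with parameters
    [a] and [b]; then [1 - s = (1 + x) / 2]. *)
Definition jac (n : nat) (a b s : C) : C :=
  csum (fun j => jac_coef n a b j * (- s) ^ j) (S n).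

Lemma jac_coef_add j m a b :
  jac_coef (j + m) a b j = poch (a + INR j + 1) m * poch (INR j + INR m + a + b + 1) j
    / (INR (fact j) * INR (fact m)).
Proof.
unfold jac_coef. rewrite (proj2 (Nat.leb_le _ _)) by lia.
replace (j + m - j)%nat with m by lia. now rewrite INR_add_C.
Qed.

Lemma jac_coef_diag n a b : jac_coef n a b n = poch (INR n + a + b + 1) n / INR (fact n).
Proof.
unfold jac_coef. rewrite Nat.leb_refl, Nat.sub_diag. simpl. field. apply fact_neq0.
Qed.

Lemma jac_coef_out n a b j : (n < j)%nat -> jac_coef n a b j = 0.
Proof. intros H. unfold jac_coef. now rewrite (proj2 (Nat.leb_gt _ _)). Qed.

Lemma jac_coef_rec0 n a b :
  (INR n + 1) * jac_coef (S n) a b 0 = (INR n + 1 + a) * jac_coef n a (b + 1) 0.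
Proof.
rewrite (jac_coef_add 0 (S n)), (jac_coef_add 0 n), fact_S_C.
cbn [poch]. change (INR 0) with 0%R. change (INR (fact 0)) with 1%R.

field. repeat split; try apply fact_neq0; apply INR_S_neq0.
Qed.

Lemma jac_coef_rec n a b j : (j <= n)%nat ->
  (INR n + 1) * jac_coef (S n) a b (S j)
  = (INR n + 1 + a) * jac_coef n a (b + 1) (S j)
    + (INR n + 1 + a) * jac_coef n a (b + 1) j + (INR n + 1 + b) * jac_coef n (a + 1) b j.
Proof.
intros H. destruct (Nat.eq_dec j n) as [->|Hne].
- rewrite (jac_coef_out n a (b + 1) (S n)) by lia.
  rewrite !jac_coef_diag, (fact_S_C n), INR_S_C.
  change (poch ?z (S n)) with (poch z n * (z + INR n)).
  replace (INR n + 1 + a + b + 1) with (INR n + a + (b + 1) + 1) by ring.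
  replace (INR n + (a + 1) + b + 1) with (INR n + a + (b + 1) + 1) by ring.
  field. split; [apply fact_neq0|apply INR_S_neq0].
- replace n with (j + S (n - S j))%nat by lia. set (m := (n - S j)%nat). clearbody m.
  replace (S (j + S m)) with (S j + S m)%nat by lia.
  rewrite !jac_coef_add. replace (j + S m)%nat with (S j + m)%nat by lia.
  rewrite !jac_coef_add, INR_add_C, !fact_S_C, !INR_S_C.
  rewrite (poch_head (a + INR j + 1) m).
  change (poch ?z (S m)) with (poch z m * (z + INR m)).
  change (poch ?z (S j)) with (poch z j * (z + INR j)).
  replace (a + INR j + 1 + 1) with (a + (INR j + 1) + 1) by ring.
  replace (a + 1 + INR j + 1) with (a + (INR j + 1) + 1) by ring.
  set (X := poch (a + (INR j + 1) + 1) m).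
  replace (INR j + 1 + (INR m + 1) + a + b + 1) with (INR j + 1 + INR m + a + (b + 1) + 1) by ring.
  replace (INR j + (INR m + 1) + a + (b + 1) + 1) with (INR j + 1 + INR m + a + (b + 1) + 1) by ring.
  replace (INR j + (INR m + 1) + (a + 1) + b + 1) with (INR j + 1 + INR m + a + (b + 1) + 1) by ring.
  set (Y := poch (INR j + 1 + INR m + a + (b + 1) + 1) j).
  field. repeat split; try apply fact_neq0; apply INR_S_neq0.
Qed.

(** A recurrence that lowers the degree by one and raises one parameter. It
    determines the whole family ([jac_unique]), so any other family that obeys
    it coincides with the Jacobi polynomials; this is how both the reflection
    formula and the generating function are obtained. *)
Lemma jac_rec n a b s :
  (INR n + 1) * jac (S n) a b s
  = (INR n + 1 + a) * (1 - s) * jac n a (b + 1) s - (INR n + 1 + b) * s * jac n (a + 1) b s.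
Proof.
unfold jac. set (A := fun j => jac_coef n a (b + 1) j * (- s) ^ j).
set (B := fun j => jac_coef n (a + 1) b j * (- s) ^ j).
(* The coefficient of index [n + 1] of a degree [n] polynomial vanishes. *)
assert (EA : csum A (S n) = A O + csum (fun j => A (S j)) (S n)).
{ rewrite <- csum_head, (csum_S A (S n)).
  unfold A at 3. rewrite jac_coef_out by lia. ring. }
replace ((INR n + 1 + a) * (1 - s) * csum A (S n) - (INR n + 1 + b) * s * csum B (S n))
  with ((INR n + 1 + a) * csum A (S n) + (- s) * ((INR n + 1 + a) * csum A (S n)
   + (INR n + 1 + b) * csum B (S n))) by ring.
rewrite EA at 1. rewrite csum_head.
set (L := csum _ (S n)) at 1.
assert (EL : (INR n + 1) * L = (INR n + 1 + a) * csum (fun j => A (S j)) (S n)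
   + (- s) * ((INR n + 1 + a) * csum A (S n) + (INR n + 1 + b) * csum B (S n))).
{ unfold L. rewrite <- !csum_scal, <- csum_plus, <- csum_scal, <- csum_plus.
  apply csum_ext. intros k Hk. rewrite Cmult_assoc, jac_coef_rec by lia.
  unfold A, B. rewrite Cpow_S. ring. }
rewrite Cmult_plus_distr_l, EL, Cmult_assoc, jac_coef_rec0. unfold A. ring.
Qed.

Lemma jac_0 a b s : jac 0 a b s = 1.
Proof. unfold jac, jac_coef. simpl. field. Qed.

Lemma jac_unique (f : nat -> C -> C -> C) (s : C) :
  (forall a b, f O a b = 1) ->
  (forall n a b, (INR n + 1) * f (S n) a b
     = (INR n + 1 + a) * (1 - s) * f n a (b + 1) - (INR n + 1 + b) * s * f n (a + 1) b) ->
  forall n a b, f n a b = jac n a b s.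
Proof.
intros H0 HS. induction n as [|n IH]; intros a b.
- now rewrite H0, jac_0.
- assert (E : (INR n + 1) * f (S n) a b = (INR n + 1) * jac (S n) a b s)
   by now rewrite HS, jac_rec, !IH.
  pose proof (INR_S_neq0 n) as Hn.
  replace (f (S n) a b) with (/ (INR n + 1) * ((INR n + 1) * f (S n) a b)) by (field; exact Hn).
  rewrite E. field. exact Hn.
Qed.

(** Exchanging [a] with [b] and [s] with [1 - s] changes the sign of the right
    hand side of the recurrence, which the factor [(-1) ^ n] compensates. *)
Lemma jac_reflect n a b s : jac n a b s = (- (1)) ^ n * jac n b a (1 - s).
Proof.
symmetry. revert n a b. apply jac_unique.
- intros. rewrite jac_0. simpl. ring.
- intros n a b. rewrite Cpow_S.
  replace ((INR n + 1) * (- (1) * (- (1)) ^ n * jac (S n) b a (1 - s)))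
   with (- (- (1)) ^ n * ((INR n + 1) * jac (S n) b a (1 - s))) by ring.
  rewrite jac_rec. ring.
Qed.

(** * A well-poised summation and the connection coefficients *)

Lemma poch_neq0 s n : (forall j, s + INR j <> 0) -> poch s n <> 0.
Proof.
intros H. induction n as [|n IH]; simpl; [apply C1_nz|]. apply Cmult_neq_0; auto.
Qed.

Lemma poch_S z n : poch z (S n) = poch z n * (z + INR n).
Proof. reflexivity. Qed.

(** Reversal of the order of the factors, with a change of all signs. *)
Lemma poch_neg z p : (- (1)) ^ p * poch z p = poch (1 - z - INR p) p.
Proof.
induction p as [|p IH]; [simpl; ring|].
rewrite (poch_head (1 - z - _)), INR_S_C, Cpow_S, poch_S.
replace (1 - z - (INR p + 1) + 1) with (1 - z - INR p) by ring.
rewrite <- IH. ring.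
Qed.

Lemma csum_telescope (G : nat -> C) n : csum (fun i => G (S i) - G i) n = G n - G O.
Proof. induction n as [|n IH]; simpl; [|rewrite IH]; ring. Qed.

Section WellPoised.
Variables (a s : C).
Hypothesis Hs : forall j, s + INR j <> 0.

(** General term of a terminating well-poised series, with [i + p] the
    index of its last term. *)
Definition wp_term (i p : nat) : C :=
  (2 * INR i + s) * poch s i * poch a i * poch (s - a + INR i + 1) p
  / (INR (fact i) * INR (fact p) * poch s (2 * i + p + 1)).

(** [wz_F] and [wz_G] form a Wilf-Zeilberger pair: the difference of [wz_F] in
    the upper parameter [m] equals the difference of [wz_G] in the summation
    index [i], so the sum of [wz_F m] over [i] does not depend on [m]. *)
Definition wz_F (m i : nat) : C :=
  if Nat.leb i m then INR (fact m) * wp_term i (m - i) else 0.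

Definition wz_G (m i : nat) : C :=
  match i with
  | O => 0
  | S i' =>
    if Nat.leb i' m then
      - (INR (fact m) * poch s i * poch a i * poch (s - a + INR i) (m - i')
         / (INR (fact i') * INR (fact (m - i')) * poch s (m + i + 1)))
    else 0
  end.

Lemma wz_F_add i p : wz_F (i + p) i = INR (fact (i + p)) * wp_term i p.
Proof.
unfold wz_F. rewrite (proj2 (Nat.leb_le _ _)) by lia. now replace (i + p - i)%nat with p by lia.
Qed.

Lemma wz_G_add i p : wz_G (i + p) (S i) =
  - (INR (fact (i + p)) * poch s (S i) * poch a (S i) * poch (s - a + INR (S i)) p
         / (INR (fact i) * INR (fact p) * poch s (2 * i + p + 2))).
Proof.
unfold wz_G. rewrite (proj2 (Nat.leb_le _ _)) by lia. replace (i + p - i)%nat with p by lia.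
now replace (i + p + S i + 1)%nat with (2 * i + p + 2)%nat by lia.
Qed.

(** After division by the common Pochhammer factors this is the identity
    [(s + i)(a + i)(M - i) - i(s - a + i)(s + i + M)
     = (2 i + s)(a M - i (s + i))] with [M = m + 1]. The index [i = m + 1], where
    [wz_F m] has stopped, and the index [i = 0], where [wz_G] vanishes, are
    treated apart. *)
Lemma wz_pair m i : (i <= S m)%nat ->
  wz_F (S m) i - wz_F m i = wz_G m (S i) - wz_G m i.
Proof.
intros Hi.
assert (Hp := fun n => poch_neq0 s n Hs).
destruct (Nat.eq_dec i (S m)) as [->|Hne].
- unfold wz_F at 2, wz_G at 1. rewrite !(proj2 (Nat.leb_gt _ _)) by lia.
  replace (wz_F (S m) (S m)) with (wz_F (S m + 0) (S m)) by (f_equal; lia).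
  replace (wz_G m (S m)) with (wz_G (m + 0) (S m)) by (f_equal; lia).
  rewrite wz_F_add, wz_G_add. unfold wp_term. rewrite !Nat.add_0_r.
  replace (2 * S m + 1)%nat with (S (2 * m + 2)) by lia.
  rewrite (poch_S s (2 * m + 2)). change (fact 0) with 1%nat.
  change (poch ?z 0) with (RtoC 1). change (INR 1) with 1%R.
  assert (Hn := Hs (2 * m + 2)). specialize (Hp (2 * m + 2)%nat).
  set (X := poch s (2 * m + 2)) in *.
  replace (RtoC (INR (2 * m + 2))) with (2 * INR (S m)) in *
    by (replace (2 * m + 2)%nat with (S m + S m)%nat by lia; rewrite INR_add_C; ring).
  field. repeat split; auto using fact_neq0.
- replace m with (i + (m - i))%nat by lia. set (p := (m - i)%nat). clearbody p.
  assert (E : wz_F (S (i + p)) i = wz_F (i + S p) i) by (f_equal; lia).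
  rewrite E, !wz_F_add, wz_G_add. clear E.
  unfold wp_term. rewrite Nat.add_succ_r.
  replace (2 * i + S p + 1)%nat with (S (2 * i + p + 1)) by lia.
  replace (2 * i + p + 2)%nat with (S (2 * i + p + 1)) by lia.
  rewrite !poch_S.
  assert (Hn := Hs (2 * i + p + 1)). specialize (Hp (2 * i + p + 1)%nat).
  set (X := poch s (2 * i + p + 1)) in *.
  assert (E : RtoC (INR (2 * i + p + 1)) = 2 * INR i + INR p + 1).
  { rewrite Nat.add_1_r, INR_S_C. replace (2 * i)%nat with (i + i)%nat by lia.
    rewrite !INR_add_C. ring. }
  rewrite E in *. rewrite !fact_S_C, INR_S_C.
  replace (s - a + (INR i + 1)) with (s - a + INR i + 1) by ring.
  destruct i as [|i].
  + simpl (wz_G _ 0). simpl (0 + p)%nat. change (fact 0) with 1%nat.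
    change (poch ?z 0) with (RtoC 1). change (INR 1) with 1%R. change (INR 0) with 0%R in *.
    set (Y := poch _ p).
    specialize (Hs O). change (INR 0) with 0%R in Hs.
    field. repeat split; auto using fact_neq0, INR_S_neq0.
    intros H0. apply Hn. transitivity (s + (INR p + 1)); [ring|exact H0].
  + assert (E' : wz_G (S i + p) (S i) = wz_G (i + S p) (S i)) by (f_equal; lia).
    rewrite E', wz_G_add. clear E'.
    replace (i + S p)%nat with (S i + p)%nat by lia.
    replace (2 * i + S p + 2)%nat with (2 * S i + p + 1)%nat by lia. fold X.
    rewrite (poch_head (s - a + INR (S i))).
    set (Y := poch (s - a + INR (S i) + 1) p).
    rewrite INR_add_C. rewrite !poch_S, !fact_S_C, !INR_S_C in *.
    set (F := INR (fact (S i + p))).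
    field. repeat split; auto using fact_neq0, INR_S_neq0.
Qed.

(** The sum of [wz_F m] is 1 because it is so for [m = 0]. *)
Lemma wp_sum m : csum (fun i => wp_term i (m - i)) (S m) = / INR (fact m).
Proof.
assert (E : forall m, csum (wz_F m) (S m) = 1).
{ clear m. induction m as [|m IH].
  - unfold wz_F, wp_term. simpl. specialize (Hs O). simpl in Hs. field.
    intros H0. apply Hs. rewrite H0. ring.
  - rewrite <- IH.
    replace (csum (wz_F m) (S m)) with (csum (wz_F m) (S (S m))).
    2:{ rewrite csum_S. unfold wz_F at 2. rewrite (proj2 (Nat.leb_gt _ _)) by lia. ring. }
    assert (E : csum (fun i => wz_F (S m) i + (- (1)) * wz_F m i) (S (S m)) = 0).
    { rewrite (csum_ext _ (fun i => wz_G m (S i) - wz_G m i)).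
      - rewrite csum_telescope. unfold wz_G. rewrite (proj2 (Nat.leb_gt _ _)) by lia. ring.
      - intros k Hk. rewrite <- wz_pair by lia. ring. }
    rewrite csum_plus, csum_scal in E.
    replace (csum (wz_F (S m)) (S (S m))) with
     (csum (wz_F m) (S (S m)) + (csum (wz_F (S m)) (S (S m)) + - (1) * csum (wz_F m) (S (S m)))) by ring.
    rewrite E. ring. }
pose proof (fact_neq0 m) as Hf.
replace (/ INR (fact m)) with (/ INR (fact m) * csum (wz_F m) (S m)) by (rewrite E; ring).
rewrite <- csum_scal. apply csum_ext. intros k Hk. unfold wz_F.
rewrite (proj2 (Nat.leb_le _ _)) by lia. field. exact Hf.
Qed.
End WellPoised.

(** Coefficient of the Jacobi polynomial of degree [k] with parameters
    [ga], [be] in the one of degree [k + n] with parameters [al], [be]. Up to a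
    factor depending on [k] only, it is the coefficient of [rho ^ n] in the
    hypergeometric function of the expansion. *)
Definition connection_coef (al be ga : C) (k n : nat) : C :=
  let s := ga + be + 1 in
  (2 * INR k + s) * poch s k * poch (be + INR k + 1) n * poch (al - ga) n
  * poch (al + be + INR k + INR n + 1) k
  / (poch s (2 * k + n + 1) * INR (fact n)).

(** Comparison of coefficients of powers of [(1 + x) / 2]. That variable is the
    right one because both families share the parameter [be], which governs the
    endpoint [x = - 1]: all the Pochhammer symbols in [be] combine to one that does
    not depend on [k], and [wp_sum] remains, with [s] and [a] shifted by [2 * j]
    and [j]. *)
Lemma connection_jac_coef al be ga j m : (forall i, ga + be + 1 + INR i <> 0) ->
  csum (fun k => (- (1)) ^ (j + m - k) * connection_coef al be ga k (j + m - k) * jac_coef k be ga j) (S (j + m))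
  = jac_coef (j + m) be al j.
Proof.
intros Hs. set (s := ga + be + 1).
(* Polynomials of degree less than [j] do not contribute; write [k = j + i]. *)
rewrite <- Nat.add_succ_r, csum_app, csum_zero.
2:{ intros k Hk. rewrite jac_coef_out by lia. ring. }
rewrite Cplus_0_l.
set (a := al + be + INR j + INR m + 1).
rewrite (csum_ext _ (fun i => poch (be + INR j + 1) m * poch a j / INR (fact j)
   * wp_term (a + INR j) (s + INR (j + j)) i (m - i))).
- rewrite csum_scal, wp_sum.
  + rewrite jac_coef_add.
    replace (INR j + INR m + be + al + 1) with a by (unfold a; ring).
    field. split; apply fact_neq0.
  + intros i. rewrite <- Cplus_assoc, <- INR_add_C. apply Hs.
- intros i Hi.
  assert (exists p, m = (i + p)%nat) as [p ->] by (exists (m - i)%nat; lia).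
  replace (j + (i + p) - (j + i))%nat with p by lia. replace (i + p - i)%nat with p by lia.
  rewrite jac_coef_add. unfold connection_coef, wp_term. fold s.
  replace (INR j + INR i + be + ga + 1) with (s + INR (j + i)) by (rewrite INR_add_C; unfold s; ring).
  replace (al + be + INR (j + i) + INR p + 1) with a by (unfold a; rewrite !INR_add_C; ring).
  replace (s + INR (j + j) - (a + INR j) + INR i + 1) with (1 - (al - ga) - INR p)
    by (unfold a, s; rewrite !INR_add_C; ring).
  rewrite <- poch_neg.
  rewrite (poch_add a j i), (poch_add (be + INR j + 1) i p).
  replace (be + INR j + 1 + INR i) with (be + INR (j + i) + 1) by (rewrite INR_add_C; ring).
  assert (E1 : poch s (j + i) * poch (s + INR (j + i)) j = poch s (j + j) * poch (s + INR (j + j)) i).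
  { rewrite <- !poch_add. f_equal. lia. }
  assert (E2 : poch s (2 * (j + i) + p + 1) = poch s (j + j) * poch (s + INR (j + j)) (2 * i + p + 1)).
  { rewrite <- poch_add. f_equal. lia. }
  rewrite E2.
  transitivity ((- (1)) ^ p * (2 * INR (j + i) + s) * (poch s (j + i) * poch (s + INR (j + i)) j)
   * poch (be + INR (j + i) + 1) p * poch (al - ga) p * (poch a j * poch (a + INR j) i) * poch (be + INR j + 1) i
   / (poch s (j + j) * poch (s + INR (j + j)) (2 * i + p + 1) * INR (fact p) * INR (fact j) * INR (fact i))).
  + field. repeat split; auto using fact_neq0.
    * apply poch_neq0. intros l. rewrite <- Cplus_assoc, <- INR_add_C. apply Hs.
    * apply poch_neq0, Hs.
  + rewrite E1. rewrite !INR_add_C. field. repeat split; auto using fact_neq0.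
    * apply poch_neq0. intros l. rewrite <- INR_add_C, <- Cplus_assoc, <- INR_add_C. apply Hs.
    * apply poch_neq0, Hs.
Qed.

Lemma csum_switch (u : nat -> nat -> C) m n :
  csum (fun i => csum (u i) n) m = csum (fun j => csum (fun i => u i j) m) n.
Proof.
induction m as [|m IH]; simpl; [symmetry; apply csum_zero; reflexivity|].
now rewrite IH, <- csum_plus.
Qed.

(** Reflection moves the expansion point from [x = 1] to [x = - 1], where
    [connection_jac_coef] compares the coefficients. *)
Lemma jac_connection al be ga z N : (forall i, ga + be + 1 + INR i <> 0) ->
  jac N al be z = csum (fun k => connection_coef al be ga k (N - k) * jac k ga be z) (S N).
Proof.
intros Hs. rewrite jac_reflect.
rewrite (csum_ext _ (fun k => (- (1)) ^ N *
  csum (fun j => (- (1)) ^ (N - k) * connection_coef al be ga k (N - k) * jac_coef k be ga j * (- (1 - z)) ^ j) (S N))).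
- rewrite csum_scal. f_equal. rewrite csum_switch. unfold jac. apply csum_ext.
  intros j Hj. replace N with (j + (N - j))%nat by lia. rewrite <- (connection_jac_coef al be ga) by exact Hs.
  rewrite Cmult_comm, <- csum_scal. apply csum_ext. intros; ring.
- intros k Hk. rewrite (jac_reflect k).
  replace (csum _ (S N)) with ((- (1)) ^ (N - k) * connection_coef al be ga k (N - k) * jac k be ga (1 - z)).
  + replace N with ((N - k) + k)%nat at 2 by lia. rewrite Cpow_add_r.
    assert (E : (- (1)) ^ (N - k) * (- (1)) ^ (N - k) = 1).
    { rewrite <- Cpow_mult_l. replace (- (1) * - (1)) with (RtoC 1) by ring. apply Cpow_1_l. }
    transitivity (((- (1)) ^ (N - k) * (- (1)) ^ (N - k)) * connection_coef al be ga k (N - k) *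
       ((- (1)) ^ k * jac k be ga (1 - z))); [rewrite E|]; ring.
  + unfold jac. rewrite <- csum_scal.
    replace (S N) with (S k + (N - k))%nat by lia. rewrite csum_app.
    rewrite (csum_zero (fun i => _ * jac_coef k be ga (S k + i)%nat * _)).
    * rewrite Cplus_0_r. apply csum_ext. intros; ring.
    * intros i Hi. rewrite jac_coef_out by lia. ring.
Qed.

(** * Subexponential coefficients and power series in the unit disc *)

(** Growth slower than every geometric sequence of ratio above 1: exactly what
    makes a power series converge absolutely in the whole unit disc. *)
Definition subexp (u : nat -> R) : Prop :=
  forall r : R, (1 < r)%R -> exists K : R, (0 <= K)%R /\ forall n, (u n <= K * r ^ n)%R.

Fixpoint rpoch (a : R) (n : nat) : R :=
  match n with O => 1%R | S m => (rpoch a m * (a + INR m))%R end.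

Lemma rpoch_ge0 a n : (0 <= a)%R -> (0 <= rpoch a n)%R.
Proof.
intros H. induction n as [|n IH]; simpl; [lra|]. pose proof (pos_INR n).
apply Rmult_le_pos; lra.
Qed.

Lemma rpoch_gt0 a n : (0 < a)%R -> (0 < rpoch a n)%R.
Proof.
intros H. induction n as [|n IH]; simpl; [lra|]. pose proof (pos_INR n).
apply Rmult_lt_0_compat; lra.
Qed.

Lemma rpoch_1 n : rpoch 1 n = INR (fact n).
Proof.
induction n as [|n IH]; [reflexivity|].
rewrite fact_simpl, mult_INR, S_INR. simpl rpoch. rewrite IH. ring.
Qed.

(** The quotient of consecutive terms tends to 1, so it is eventually below [r];
    the finitely many other terms only affect the constant. *)
Lemma rpoch_ratio_subexp a b :
  (0 <= a)%R -> (0 < b)%R -> subexp (fun n => rpoch a n / rpoch b n)%R.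
Proof.
intros Ha Hb r Hr.
assert (Hq : forall n, (0 <= rpoch a n / rpoch b n)%R).
{ intros n. apply Rmult_le_pos; [now apply rpoch_ge0|].
  left. apply Rinv_0_lt_compat. now apply rpoch_gt0. }
assert (Hrn : forall n, (0 < r ^ n)%R) by (intros; apply pow_lt; lra).
assert (Hfin : forall N, exists K, (0 <= K)%R /\
  forall n, (n <= N)%nat -> (rpoch a n / rpoch b n <= K * r ^ n)%R).
{ induction N as [|N [K [HK IH]]].
  - exists 1%R. split; [lra|]. intros n Hn. replace n with O by lia. simpl. lra.
  - exists (K + rpoch a (S N) / rpoch b (S N))%R. split; [specialize (Hq (S N)); lra|].
    intros n Hn. destruct (Nat.eq_dec n (S N)) as [->|Hne].
    + pose proof (Rle_pow r 0 (S N) ltac:(lra) ltac:(lia)) as H1. simpl (r ^ 0)%R in H1.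
      specialize (Hq (S N)). specialize (Hrn (S N)). nra.
    + specialize (IH n ltac:(lia)). specialize (Hq (S N)). specialize (Hrn n). nra. }
(* Beyond this index, [a + n <= r * (b + n)]. *)
destruct (nfloor_ex (Rabs ((a - r * b) / (r - 1))) (Rabs_pos _)) as [N0 [_ HN0]].
destruct (Hfin (S N0)) as [K [HK HF]].
exists K. split; [exact HK|].
intros n. destruct (Nat.le_gt_cases n (S N0)) as [H|H]; [now apply HF|].
replace n with (S N0 + (n - S N0))%nat by lia. generalize (n - S N0)%nat as m. clear n H.
induction m as [|m IH]; [rewrite Nat.add_0_r; now apply HF|].
rewrite Nat.add_succ_r. set (n := (S N0 + m)%nat) in *.
change (rpoch ?c (S n)) with (rpoch c n * (c + INR n))%R. change (r ^ S n)%R with (r * r ^ n)%R.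
pose proof (rpoch_gt0 b n Hb) as Hbn.
assert (Hn : (INR N0 + 1 <= INR n)%R).
{ rewrite <- S_INR. apply le_INR. unfold n. lia. }
pose proof (pos_INR N0).
assert (Hnb : (0 < b + INR n)%R) by lra.
replace (rpoch a n * (a + INR n) / (rpoch b n * (b + INR n)))%R with
  (rpoch a n / rpoch b n * ((a + INR n) / (b + INR n)))%R by (field; lra).
replace (K * (r * r ^ n))%R with (K * r ^ n * r)%R by ring.
apply Rmult_le_compat; [apply Hq| |exact IH|].
- apply Rmult_le_pos; [lra|]. left. now apply Rinv_0_lt_compat.
- apply Rle_div_l; [exact Hnb|].
  assert ((a - r * b) / (r - 1) < INR n)%R.
  { pose proof (Rle_abs ((a - r * b) / (r - 1))). lra. }
  apply Rlt_div_l in H0; lra.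
Qed.

Lemma subexp_le u v : (forall n, u n <= v n)%R -> subexp v -> subexp u.
Proof.
intros H Hv r Hr. destruct (Hv r Hr) as [K [HK HvK]]. exists K. split; [exact HK|].
intros n. eapply Rle_trans; eauto.
Qed.

Lemma subexp_geom (f : nat -> C) (z : C) :
  subexp (fun n => Cmod (f n)) -> (Cmod z < 1)%R ->
  exists K q, (0 < q < 1)%R /\ (0 <= K)%R /\ forall n, (Cmod (f n * z ^ n) <= K * q ^ n)%R.
Proof.
intros Hf Hz. pose proof (Cmod_ge_0 z) as Hz0.
(* [Cmod z < p < 1], and [r] is chosen so that [r * p < 1]. *)
set (p := ((1 + Cmod z) / 2)%R).
assert (Hp : (0 < p < 1 /\ Cmod z < p)%R) by (unfold p; lra).
set (r := (2 / (1 + p))%R).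
assert (Hr : (1 < r)%R) by (unfold r; apply Rlt_div_r; lra).
destruct (Hf r Hr) as [K [HK HfK]].
exists K, (r * p)%R. repeat split.
- apply Rmult_lt_0_compat; lra.
- unfold r. replace (2 / (1 + p) * p)%R with (2 * p / (1 + p))%R by (field; lra). apply Rlt_div_l; lra.
- exact HK.
- intros n. rewrite Cmod_mult, Cmod_pow, Rpow_mult_distr, <- Rmult_assoc.
  apply Rmult_le_compat; try apply Cmod_ge_0; auto.
  + apply pow_le, Cmod_ge_0.
  + apply pow_incr. lra.
Qed.

Lemma ex_sum_subexp (f : nat -> C) (z : C) :
  subexp (fun n => Cmod (f n)) -> (Cmod z < 1)%R -> ex_Cseries (fun n => f n * z ^ n).
Proof.
intros Hf Hz. destruct (subexp_geom f z Hf Hz) as [K [q [Hq [HK H]]]].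
apply (ex_sum_geom _ K q); [lra|exact H].
Qed.

Lemma cauchy_pow (f g : nat -> C) (z : C) n :
  cauchy (fun n => f n * z ^ n) (fun n => g n * z ^ n) n = cauchy f g n * z ^ n.
Proof.
unfold cauchy. rewrite Cmult_comm, <- csum_scal. apply csum_ext. intros k Hk.
replace n with (k + (n - k))%nat at 3 by lia. rewrite Cpow_add_r. ring.
Qed.

Lemma is_sum_cauchy_pow (f g : nat -> C) (z F G : C) :
  subexp (fun n => Cmod (f n)) -> subexp (fun n => Cmod (g n)) -> (Cmod z < 1)%R ->
  is_sum (fun n => f n * z ^ n) F -> is_sum (fun n => g n * z ^ n) G ->
  is_sum (fun n => cauchy f g n * z ^ n) (F * G).
Proof.
intros Hf Hg Hz HF HG.
destruct (subexp_geom f z Hf Hz) as [K [q [Hq [HK H]]]].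
destruct (subexp_geom g z Hg Hz) as [K' [q' [Hq' [HK' H']]]].
eapply is_sum_ext; [intros n; apply cauchy_pow|].
apply (is_sum_cauchy _ _ F G K K' (Rmax q q')); auto.
- split; [|apply Rmax_lub_lt; lra]. eapply Rle_trans, Rmax_l. lra.
- intros n. eapply Rle_trans; [apply H|]. apply Rmult_le_compat_l; [exact HK|].
  apply pow_incr. split; [lra|apply Rmax_l].
- intros n. eapply Rle_trans; [apply H'|]. apply Rmult_le_compat_l; [exact HK'|].
  apply pow_incr. split; [lra|apply Rmax_r].
Qed.

(** * Differentiation along a real parameter *)

(** Functions on the disc are only differentiated along rays [t * z] with real
    [t], which reduces complex analysis to pairs of real functions. *)
Definition Cder (f : R -> C) (t : R) (l : C) : Prop :=
  is_derive (fun t => Re (f t)) t (Re l) /\ is_derive (fun t => Im (f t)) t (Im l).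

Lemma Cder_eq f t l l' : Cder f t l -> l = l' -> Cder f t l'.
Proof. now intros H <-. Qed.

Lemma is_derive_eq (f : R -> R) t l l' : is_derive f t l -> l = l' -> is_derive f t l'.
Proof. now intros H <-. Qed.

Lemma Cder_const c t : Cder (fun _ => c) t 0.
Proof. split; apply (is_derive_const (V:=R_NormedModule)). Qed.

Lemma Cder_lin w t : Cder (fun t => RtoC t * w) t w.
Proof. split; unfold Re, Im; simpl; auto_derive; auto; ring. Qed.

Lemma Cder_plus f g t l m : Cder f t l -> Cder g t m -> Cder (fun t => f t + g t) t (l + m).
Proof. intros [H1 H2] [H3 H4]. split; now apply (is_derive_plus (V:=R_NormedModule)). Qed.

Lemma Cder_mult f g t l m :
  Cder f t l -> Cder g t m -> Cder (fun t => f t * g t) t (l * g t + f t * m).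
Proof.
intros [H1 H2] [H3 H4].
assert (D := fun a b la lb Ha Hb => is_derive_mult (K:=R_AbsRing) a b t la lb Ha Hb Rmult_comm).
split.
- eapply is_derive_eq.
  + apply (is_derive_minus (V:=R_NormedModule) _ _ t _ _ (D _ _ _ _ H1 H3) (D _ _ _ _ H2 H4)).
  + unfold minus, plus, opp, mult, Re, Im; simpl. ring.
- eapply is_derive_eq.
  + apply (is_derive_plus (V:=R_NormedModule) _ _ t _ _ (D _ _ _ _ H1 H4) (D _ _ _ _ H2 H3)).
  + unfold plus, mult, Re, Im; simpl. ring.
Qed.

Lemma Cder_scal c f t l : Cder f t l -> Cder (fun t => c * f t) t (c * l).
Proof.
intros H. eapply Cder_eq; [apply (Cder_mult _ _ _ _ _ (Cder_const c t) H)|]. ring.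
Qed.

Lemma is_derive_val (f : R -> R) t l : is_derive f t l -> ex_derive f t /\ Derive f t = l.
Proof. intros H. split; [now exists l|now apply is_derive_unique]. Qed.

Lemma Cder_Cexp f t l : Cder f t l -> Cder (fun t => Cexp (f t)) t (l * Cexp (f t)).
Proof.
intros [H1 H2].
pose (u := fun t => Re (f t)). pose (v := fun t => Im (f t)).
change (is_derive u t (Re l)) in H1. change (is_derive v t (Im l)) in H2.
apply is_derive_val in H1, H2. destruct H1 as [H1 E1], H2 as [H2 E2].
split.
- apply (is_derive_ext (fun t => exp (u t) * cos (v t))%R).
  + intros s. unfold Cexp, u, v, Re, Im. simpl. ring.
  + replace (Re (l * Cexp (f t))) with
      (exp (u t) * (Re l * cos (v t) - Im l * sin (v t)))%R
      by (unfold Cexp, u, v, Re, Im; simpl; ring).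
    rewrite <- E1, <- E2. auto_derive; [tauto|]. change (fun x : R => u x) with u. change (fun x : R => v x) with v. ring.
- apply (is_derive_ext (fun t => exp (u t) * sin (v t))%R).
  + intros s. unfold Cexp, u, v, Re, Im. simpl. ring.
  + replace (Im (l * Cexp (f t))) with
      (exp (u t) * (Im l * cos (v t) + Re l * sin (v t)))%R
      by (unfold Cexp, u, v, Re, Im; simpl; ring).
    rewrite <- E1, <- E2. auto_derive; [tauto|]. change (fun x : R => u x) with u. change (fun x : R => v x) with v. ring.
Qed.

(** On the right half-plane the principal argument is the arctangent of a
    quotient, which is smooth; elsewhere this is not the principal branch. *)
Definition Log (z : C) : C := (ln (Cmod z), atan (Im z / Re z)).

Lemma Cder_Log f t l :
  Cder f t l -> (0 < Re (f t))%R -> Cder (fun t => Log (f t)) t (l / f t).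
Proof.
intros [H1 H2] Hp.
pose (u := fun t => Re (f t)). pose (v := fun t => Im (f t)).
change (is_derive u t (Re l)) in H1. change (is_derive v t (Im l)) in H2.
apply is_derive_val in H1, H2. destruct H1 as [H1 E1], H2 as [H2 E2].
change (0 < u t)%R in Hp.
assert (Hs : (0 < u t * u t + v t * v t)%R) by nra.
assert (El : l / f t = ((Re l * u t + Im l * v t) / (u t * u t + v t * v t),
   (Im l * u t - Re l * v t) / (u t * u t + v t * v t))%R).
{ unfold u, v in *. destruct l as [l1 l2], (f t) as [a b]. unfold Re, Im, Cdiv, Cinv, Cmult in *. simpl in *.
  f_equal; field; repeat split; nra. }
rewrite El. rewrite <- E1, <- E2.
split.
- apply (is_derive_ext (fun t => ln (sqrt (u t * u t + v t * v t)))%R).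
  + intros s. unfold Log, Cmod, u, v, Re, Im. simpl. do 2 f_equal. ring.
  + auto_derive.
    * repeat split; auto. now apply sqrt_lt_R0.
    * change (fun x : R => u x) with u. change (fun x : R => v x) with v. simpl.
      assert (Hq := sqrt_lt_R0 _ Hs). assert (Hqq := sqrt_sqrt _ (Rlt_le _ _ Hs)).
      rewrite <- Hqq at 3. field. lra.
- apply (is_derive_ext (fun t => atan (v t / u t))%R).
  + intros s. reflexivity.
  + auto_derive.
    * repeat split; auto. lra.
    * change (fun x : R => u x) with u. change (fun x : R => v x) with v. simpl.
      unfold Rsqr. field. repeat split; try lra; nra.
Qed.

Lemma Cder_zero_const f :
  (forall t, (0 <= t <= 1)%R -> Cder f t 0) -> f 1%R = f 0%R.
Proof.
intros H.
assert (E : forall g : R -> R, (forall t, (0 <= t <= 1)%R -> is_derive g t 0%R) -> g 1%R = g 0%R).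
{ intros g Hg. destruct (MVT_gen g 0 1 (fun _ => 0%R)) as [c [_ Hc]].
  - intros t Ht. apply Hg. rewrite Rmin_left, Rmax_right in Ht by lra. lra.
  - intros t Ht. rewrite Rmin_left, Rmax_right in Ht by lra.
    apply continuity_pt_filterlim, (ex_derive_continuous (K:=R_AbsRing) (V:=R_NormedModule) g t). exists 0%R. now apply Hg.
  - lra. }
assert (E1 := E (fun t => Re (f t)) (fun t Ht => proj1 (H t Ht))).
assert (E2 := E (fun t => Im (f t)) (fun t Ht => proj2 (H t Ht))).
cbv beta in E1, E2. destruct (f 1%R), (f 0%R). unfold Re, Im in *. simpl in *. now f_equal.
Qed.

Lemma Cexp_plus a b : Cexp (a + b) = Cexp a * Cexp b.
Proof.
destruct a as [a1 a2], b as [b1 b2]. unfold Cexp, Cplus, Cmult, Re, Im, RtoC. simpl.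
rewrite exp_plus, cos_plus, sin_plus. f_equal; ring.
Qed.

Lemma Cexp_0 : Cexp 0 = 1.
Proof. unfold Cexp, Re, Im, RtoC, Cmult. simpl. rewrite exp_0, cos_0, sin_0. f_equal; ring. Qed.

Lemma Cexp_opp_r a : Cexp a * Cexp (- a) = 1.
Proof. rewrite <- Cexp_plus, <- Cexp_0. f_equal. ring. Qed.

Lemma Cexp_neq0 a : Cexp a <> 0.
Proof. intros H. pose proof (Cexp_opp_r a) as E. rewrite H, Cmult_0_l in E. now apply C1_nz. Qed.

(** * Power series with a prescribed logarithmic derivative *)

(** [logder_hist g n] stores the terms of index at most [n]; the history is
    needed because each term depends on all the preceding ones. *)
Fixpoint logder_hist (g : nat -> C) (n : nat) : nat -> C :=
  match n with
  | O => fun _ => 1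
  | S m => fun k => if Nat.leb k m then logder_hist g m k
                    else cauchy (logder_hist g m) g m / (INR m + 1)
  end.

(** Coefficients of the solution of [f' = f * g] with [f 0 = 1]. *)
Definition logder_seq (g : nat -> C) (n : nat) : C := logder_hist g n n.

Lemma logder_hist_stable g n k : (k <= n)%nat -> logder_hist g n k = logder_seq g k.
Proof.
induction n as [|n IH]; intros H.
- now replace k with O by lia.
- destruct (Nat.eq_dec k (S n)) as [->|Hne]; [reflexivity|].
  simpl. rewrite (proj2 (Nat.leb_le _ _)) by lia. apply IH. lia.
Qed.

Lemma logder_seq_rec g n :
  (INR n + 1) * logder_seq g (S n) = cauchy (logder_seq g) g n.
Proof.
unfold logder_seq at 1. cbn [logder_hist].
rewrite (proj2 (Nat.leb_gt _ _)) by lia.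
replace (cauchy (logder_hist g n) g n) with (cauchy (logder_seq g) g n).
- field. apply INR_S_neq0.
- apply csum_ext. intros k Hk. now rewrite logder_hist_stable by lia.
Qed.

Section LogDer.
Variables (g : nat -> C) (M : R).
Hypothesis HM : forall n, (Cmod (g n) <= M)%R.
Let f := logder_seq g.

Lemma logder_M_ge0 : (0 <= M)%R.
Proof. eapply Rle_trans; [apply Cmod_ge_0|apply (HM O)]. Qed.

(** The bound is attained by [(1 - z) ^ (- M)], whose logarithmic
    derivative [M / (1 - z)] has all its coefficients equal to [M]. *)
Lemma logder_bound n : (Cmod (f n) <= rpoch M n / rpoch 1 n)%R.
Proof.
pose proof logder_M_ge0 as M0.
assert (P1 : forall n, (0 < rpoch 1 n)%R) by (intros; apply rpoch_gt0; lra).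
(* The recurrence of [logder_seq], for the coefficients of the majorant. *)
assert (ES : forall n, (M * sum_f_R0 (fun k => rpoch M k / rpoch 1 k) n
   = INR (S n) * (rpoch M (S n) / rpoch 1 (S n)))%R).
{ clear n. induction n as [|n IH].
  - simpl. field.
  - rewrite tech5, Rmult_plus_distr_l, IH.
    change (rpoch ?c (S (S n))) with (rpoch c (S n) * (c + INR (S n)))%R.
    rewrite !S_INR. pose proof (P1 (S n)). pose proof (pos_INR n). field. lra. }
induction n as [n IH] using (well_founded_ind Nat.lt_wf_0). destruct n as [|n].
- unfold f, logder_seq. simpl. rewrite Cmod_1. lra.
- pose proof (pos_INR n) as Hn.
  assert (E : Cmod ((INR n + 1) * f (S n)) = (INR (S n) * Cmod (f (S n)))%R).
  { rewrite Cmod_mult, <- INR_S_C, Cmod_R, Rabs_pos_eq; [reflexivity|apply pos_INR]. }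
  apply (Rmult_le_reg_l (INR (S n))); [rewrite S_INR; lra|].
  rewrite <- E, <- ES. unfold f. rewrite logder_seq_rec. fold f.
  eapply Rle_trans; [apply (Cmod_csum_le _ (fun k => M * (rpoch M k / rpoch 1 k)))%R|].
  + intros k Hk. rewrite Cmod_mult, Rmult_comm.
    apply Rmult_le_compat; auto using Cmod_ge_0.
  + rewrite tech5, scal_sum. right.
    rewrite (sum_eq _ (fun k => rpoch M k / rpoch 1 k * M)%R); [|intros; ring]. ring.
Qed.

Lemma logder_subexp : subexp (fun n => Cmod (f n)).
Proof.
eapply subexp_le; [apply logder_bound|]. apply rpoch_ratio_subexp; [apply logder_M_ge0|lra].
Qed.

Lemma coef_subexp : subexp (fun n => Cmod (g n)).
Proof.
intros r Hr. exists M. split; [apply logder_M_ge0|]. intros n.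
eapply Rle_trans; [apply HM|]. pose proof logder_M_ge0.
pose proof (Rle_pow r 0 n ltac:(lra) ltac:(lia)) as H1. simpl in H1. nra.
Qed.

Lemma Cmod_tz_lt1 t z : (Cmod z < 1)%R -> (0 <= t <= 1)%R -> (Cmod (t * z) < 1)%R.
Proof.
intros Hz Ht. rewrite Cmod_mult, Cmod_R, Rabs_pos_eq by lra. pose proof (Cmod_ge_0 z). nra.
Qed.

Lemma logder_derivative z F G : (Cmod z < 1)%R ->
  is_sum (fun n => f n * z ^ n) F -> is_sum (fun n => g n * z ^ n) G ->
  is_sum (fun n => (INR n + 1) * f (S n) * z ^ n) (F * G).
Proof.
intros Hz HF HG. eapply is_sum_ext, is_sum_cauchy_pow.
- intros n. unfold f. now rewrite logder_seq_rec.
- exact logder_subexp.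
- exact coef_subexp.
- exact Hz.
- exact HF.
- exact HG.
Qed.

(** Along a ray, the real and imaginary parts of the sum are real power series
    in [t] of radius at least [/ q] with [q < 1], hence differentiable up to
    [t = 1]. *)
Lemma Cder_logder z t (Y G : C) : (Cmod z < 1)%R -> (0 <= t <= 1)%R ->
  is_sum (fun n => f n * (t * z) ^ n) Y -> is_sum (fun n => g n * (t * z) ^ n) G ->
  Cder (fun t => Csum (fun n => f n * (t * z) ^ n)) t (z * (Y * G)).
Proof.
intros Hz Ht HY HG.
destruct (subexp_geom f z logder_subexp Hz) as [K [q [Hq [HK H]]]].
assert (HD := logder_derivative _ _ _ (Cmod_tz_lt1 t z Hz Ht) HY HG).
apply (is_sum_scal z), is_sum_Re_Im in HD.
assert (E : forall (p : C -> R), (forall a, Rabs (p a) <= Cmod a)%R ->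
   (forall (c : R) a, p (RtoC c * a)%C = c * p a)%R ->
   is_series (fun n => p (z * ((INR n + 1) * f (S n) * (t * z) ^ n))) (p (z * (Y * G))) ->
   is_derive (fun t => Series (fun n => p (f n * (RtoC t * z) ^ n))) t (p (z * (Y * G)))).
{ intros p Hp Hpc HS.
  set (a := fun n => p (f n * z ^ n)).
  assert (Ea : forall s n, p (f n * (RtoC s * z) ^ n) = (a n * s ^ n)%R).
  { intros s n. rewrite Cpow_mult_l, <- RtoC_pow.
    replace (f n * (RtoC (s ^ n) * z ^ n)) with (RtoC (s ^ n) * (f n * z ^ n)) by ring.
    rewrite Hpc. unfold a. ring. }
  apply (is_derive_ext (PSeries a)).
  { intros s. unfold PSeries. apply Series_ext. intros n. symmetry. apply Ea. }
  assert (HR : Rbar_lt (Rabs t) (CV_radius a)).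
  { apply Rbar_lt_le_trans with (/ q)%R.
    - assert (1 < / q)%R by (rewrite <- (Rmult_1_l (/ q)); apply (Rlt_div_r 1 1 q); lra).
      simpl. rewrite Rabs_pos_eq by lra. lra.
    - apply (proj1 (CV_radius_bounded a)). exists K. intros n.
      rewrite Rabs_mult, <- RPow_abs, (Rabs_pos_eq (/ q)), pow_inv
       by (left; apply Rinv_0_lt_compat; lra).
      assert (0 < q ^ n)%R by (apply pow_lt; lra).
      apply Rle_div_l; [lra|]. eapply Rle_trans; [apply Hp|apply H]. }
  eapply is_derive_eq; [apply is_derive_PSeries, HR|].
  apply is_series_unique. eapply is_series_ext, HS.
  intros n. unfold PS_derive. cbv beta.
  rewrite <- INR_S_C.
  replace (z * (INR (S n) * f (S n) * (t * z) ^ n))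
    with (RtoC (INR (S n) * t ^ n) * (f (S n) * z ^ S n)).
  - rewrite Hpc. unfold a. match goal with |- ?x = ?y => change (@eq R x y) end. ring.
  - rewrite RtoC_mult, RtoC_pow, Cpow_mult_l, Cpow_S. ring. }
split.
- apply (E Re); [apply re_le_Cmod| |apply HD].
  intros c [a1 a2]. unfold Re, Cmult, RtoC. simpl. ring.
- apply (E Im); [| |apply HD].
  + intros a. apply (Rle_trans _ _ _ (Rmax_r _ _) (Rmax_Cmod a)).
  + intros c [a1 a2]. unfold Im, Cmult, RtoC. simpl. ring.
Qed.

(** A function whose logarithmic derivative along rays is the sum of [g] is the
    sum of [logder_seq g] in the whole disc: the quotient of the two has zero
    derivative on the segment from 0 to [z]. Writing the function as an
    exponential makes its inverse available without division. *)
Lemma logder_sum z (phi G : R -> C) : (Cmod z < 1)%R ->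
  (forall t, (0 <= t <= 1)%R -> is_sum (fun n => g n * (t * z) ^ n) (G t)) ->
  (forall t, (0 <= t <= 1)%R -> Cder phi t (z * G t)) ->
  Cexp (phi 0%R) = 1 ->
  is_sum (fun n => f n * z ^ n) (Cexp (phi 1%R)).
Proof.
intros Hz HG Hphi H0.
set (y := fun t : R => Csum (fun n => f n * (t * z) ^ n)).
assert (Hy : forall t, (0 <= t <= 1)%R -> is_sum (fun n => f n * (t * z) ^ n) (y t)).
{ intros t Ht. apply is_sum_of_ex, ex_sum_subexp; [exact logder_subexp|now apply Cmod_tz_lt1]. }
assert (E : y 1%R * Cexp (- (1) * phi 1%R) = y 0%R * Cexp (- (1) * phi 0%R)).
{ apply (Cder_zero_const (fun t => y t * Cexp (- (1) * phi t))).
  intros t Ht. eapply Cder_eq.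
  - apply Cder_mult.
    + apply Cder_logder; auto.
    + apply Cder_Cexp, Cder_scal, Hphi, Ht.
  - cbv beta. fold (y t). ring. }
assert (Ey0 : y 0%R = 1).
{ apply is_sum_Csum. replace (RtoC 1) with (csum (fun n => f n * (0%R * z) ^ n) 1).
  - apply is_sum_finite. intros k Hk. destruct k; [lia|]. rewrite Cpow_S. ring.
  - simpl. unfold f, logder_seq. simpl. ring. }
assert (EE : forall w, Cexp w * Cexp (- (1) * w) = 1).
{ intros w. replace (- (1) * w) with (- w) by ring. apply Cexp_opp_r. }
pose proof (EE (phi 0%R)) as E0. rewrite H0, Cmult_1_l in E0.
rewrite Ey0, E0, Cmult_1_l in E.
specialize (Hy 1%R ltac:(lra)).
replace (Cexp (phi 1%R)) with (y 1%R).
- eapply is_sum_ext, Hy. intros n. now rewrite Cmult_1_l.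
- replace (y 1%R) with (y 1%R * (Cexp (phi 1%R) * Cexp (- (1) * phi 1%R))) by (rewrite EE; ring).
  transitivity (Cexp (phi 1%R) * (y 1%R * Cexp (- (1) * phi 1%R))); [ring|rewrite E; ring].
Qed.
End LogDer.

(** Uniqueness of coefficients, from real power series by restriction to real
    [z]. *)
Lemma coef_zero (a : nat -> C) :
  (forall z, (Cmod z < 1)%R -> is_sum (fun n => a n * z ^ n) (RtoC 0)) ->
  forall n, a n = 0.
Proof.
intros H n.
assert (E : forall (p : C -> R),
   (forall (c : R) a, p (RtoC c * a)%C = c * p a)%R ->
   (forall z, (Cmod z < 1)%R -> is_series (fun n => p (a n * z ^ n)) 0%R) -> p (a n) = 0%R).
{ intros p Hpc HS.
  assert (HR : Rbar_lt 0%R (CV_radius (fun n => p (a n)))).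
  { apply Rbar_not_le_lt. intros Hle.
    assert (Hh : (Cmod (RtoC (/ 2)) < 1)%R) by (rewrite Cmod_R, Rabs_pos_eq; lra).
    apply (CV_disk_outside (fun n => p (a n)) (/ 2)%R).
    - eapply Rbar_le_lt_trans; [exact Hle|]. simpl. rewrite Rabs_pos_eq; lra.
    - apply ex_series_lim_0. exists 0%R. eapply is_series_ext, (HS _ Hh). intros m. cbv beta.
      rewrite <- RtoC_pow, Cmult_comm, Hpc.
      match goal with |- ?x = ?y => change (@eq R x y) end. ring. }
  rewrite (PSeries_ext_recip (fun n => p (a n)) (fun _ => 0%R) n); auto.
  - rewrite CV_radius_const_0. exact I.
  - exists (mkposreal 1 Rlt_0_1). intros x Hx.
    rewrite PSeries_const_0. unfold PSeries. apply is_series_unique.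
    assert (Hx1 : (Cmod (RtoC x) < 1)%R).
    { rewrite Cmod_R. change (Rabs (x - 0) < 1)%R in Hx. now rewrite Rminus_0_r in Hx. }
    eapply is_series_ext, (HS _ Hx1). intros m. cbv beta.
    rewrite <- RtoC_pow, Cmult_comm, Hpc. match goal with |- ?x = ?y => change (@eq R x y) end. ring. }
assert (H' := fun z Hz => is_sum_Re_Im _ _ (H z Hz)).
assert (E1 : Re (a n) = 0%R).
{ apply (E Re); [|intros z Hz; apply (H' z Hz)].
  intros c [a1 a2]. unfold Re, Cmult, RtoC. simpl. ring. }
assert (E2 : Im (a n) = 0%R).
{ apply (E Im); [|intros z Hz; apply (H' z Hz)].
  intros c [a1 a2]. unfold Im, Cmult, RtoC. simpl. ring. }
destruct (a n). unfold Re, Im in *. simpl in *. now subst.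
Qed.

(** * Polar form and principal branches in the right half-plane *)

Lemma Cmod_polar r t : (0 <= r)%R -> Cmod (r * cos t, r * sin t)%R = r.
Proof.
intros Hr. unfold Cmod. simpl.
replace (_ + _)%R with (r * r)%R; [now apply sqrt_square|].
pose proof (sin2_cos2 t) as H. unfold Rsqr in H.
transitivity (r * r * (sin t * sin t + cos t * cos t))%R; [rewrite H|]; ring.
Qed.

Lemma Carg_polar r t : (0 < r)%R -> (- PI < t <= PI)%R -> Carg (r * cos t, r * sin t)%R = t.
Proof.
intros Hr Ht. unfold Carg. rewrite Cmod_polar by lra. unfold Re, Im. simpl.
replace (r * cos t / r)%R with (cos t) by (field; lra).
destruct (Rle_dec 0 (r * sin t)) as [H|H].
- destruct (Rle_or_lt 0 t) as [H0|H0]; [apply acos_cos; lra|].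
  exfalso. pose proof (sin_lt_0_var t ltac:(lra) H0). nra.
- destruct (Rle_or_lt 0 t) as [H0|H0].
  + exfalso. apply H. apply Rmult_le_pos; [lra|]. apply sin_ge_0; lra.
  + rewrite <- cos_neg, acos_cos by lra. ring.
Qed.

Lemma polar_of_Re_pos z : (0 < Re z)%R ->
  z = (Cmod z * cos (atan (Im z / Re z)), Cmod z * sin (atan (Im z / Re z)))%R.
Proof.
destruct z as [a b]. unfold Re, Im. simpl. intros Ha.
assert (E : sqrt (1 + (b / a)²) = (Cmod (a, b) / a)%R).
{ transitivity (sqrt (a ^ 2 + b ^ 2) / sqrt (a * a))%R.
  - rewrite <- sqrt_div_alt by nra. f_equal. unfold Rsqr. field. lra.
  - now rewrite sqrt_square by lra. }
assert (Hm : (0 < Cmod (a, b))%R).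
{ apply Cmod_gt_0. intros H. injection H. intros. lra. }
rewrite cos_atan, sin_atan, E. f_equal; field; split; lra.
Qed.

Lemma Clog_Log z : (0 < Re z)%R -> Clog z = Log z.
Proof.
intros H. unfold Clog, Log. f_equal.
pose proof (atan_bound (Im z / Re z)) as Hb.
rewrite (polar_of_Re_pos z H) at 1. apply Carg_polar; [|lra].
apply Cmod_gt_0. intros ->. unfold Re in H. simpl in H. lra.
Qed.

Lemma Cexp_Log z : (0 < Re z)%R -> Cexp (Log z) = z.
Proof.
intros H. unfold Cexp, Log. unfold Re at 1, Im at 1 2. simpl.
rewrite exp_ln.
- rewrite (polar_of_Re_pos z H) at 6. unfold Cmult, RtoC. simpl. f_equal; ring.
- apply Cmod_gt_0. intros ->. unfold Re in H. simpl in H. lra.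
Qed.

(** If [w] has argument [t] in the open right half-plane, then [2 * t] is the
    principal argument of [w * w], and halving it gives back [t]. *)
Lemma Csqrt_unique w z : w * w = z -> (0 < Re w)%R -> Csqrt z = w.
Proof.
intros Hz H. pose proof (polar_of_Re_pos w H) as Hw.
pose proof (atan_bound (Im w / Re w)) as Hb.
set (t := atan (Im w / Re w)) in *.
assert (Hm : (0 < Cmod w)%R).
{ apply Cmod_gt_0. intros ->. unfold Re in H. simpl in H. lra. }
set (r := Cmod w) in *.
assert (Ez : z = (r * r * cos (2 * t), r * r * sin (2 * t))%R).
{ rewrite <- Hz, Hw. unfold Cmult. simpl. rewrite cos_2a, sin_2a. f_equal; ring. }
assert (Hr2 : (0 < r * r)%R) by nra.
unfold Csqrt. rewrite Ez, Carg_polar, Cmod_polar, sqrt_square by lra.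
rewrite Hw. replace (2 * t / 2)%R with t by field.
unfold Cexp, Ci, Cmult, RtoC, Re, Im. simpl.
replace (0 * t - 1 * 0)%R with 0%R by ring. replace (0 * 0 + 1 * t)%R with t by ring.
rewrite exp_0. f_equal; ring.
Qed.

Lemma Cpower_Log z a : (0 < Re z)%R -> Cpower z a = Cexp (a * Log z).
Proof. intros H. unfold Cpower. now rewrite Clog_Log. Qed.

Lemma Re_pos_neq0 z : (0 < Re z)%R -> z <> 0.
Proof. intros H ->. unfold Re in H. simpl in H. lra. Qed.

Lemma Re_1_minus z : (Cmod z < 1)%R -> (0 < Re (1 - z))%R.
Proof.
intros H. pose proof (re_le_Cmod z) as H1. pose proof (Rle_abs (Re z)).
unfold Re in *. simpl. lra.
Qed.

Lemma Cder_ext f g t l : (forall s, f s = g s) -> Cder f t l -> Cder g t l.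
Proof.
intros E [H1 H2]. split.
- apply (is_derive_ext (fun t => Re (f t))); [intros s; now rewrite E|exact H1].
- apply (is_derive_ext (fun t => Im (f t))); [intros s; now rewrite E|exact H2].
Qed.

(** * The generating function of the Jacobi polynomials *)

Section Gen.
Variable x : R.
Hypothesis hx : (-1 <= x <= 1)%R.

(** For [x = cos theta] these are [exp (i theta)] and [exp (- i theta)], so that
    [1 - 2 z x + z ^ 2 = (1 - unit_up * z) * (1 - unit_dn * z)] has both
    factors in the right half-plane for [z] in the disc. *)
Definition unit_up : C := (x, sqrt (1 - x * x)).
Definition unit_dn : C := (x, - sqrt (1 - x * x))%R.

Lemma unit_sum : unit_up + unit_dn = 2 * x.
Proof. unfold unit_up, unit_dn, Cplus, Cmult, RtoC. simpl. f_equal; ring. Qed.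

Lemma unit_mul : unit_up * unit_dn = 1.
Proof.
unfold unit_up, unit_dn, Cmult, RtoC. simpl. f_equal; [|ring].
assert (H : (sqrt (1 - x * x) * sqrt (1 - x * x) = 1 - x * x)%R) by (apply sqrt_sqrt; nra).
nra.
Qed.

Lemma Cmod_unit_up : Cmod unit_up = 1%R.
Proof.
unfold Cmod, unit_up. simpl. transitivity (sqrt 1); [f_equal|apply sqrt_1].
assert (H : (sqrt (1 - x * x) * sqrt (1 - x * x) = 1 - x * x)%R) by (apply sqrt_sqrt; nra).
rewrite !Rmult_1_r, H. ring.
Qed.

Lemma Cmod_unit_dn : Cmod unit_dn = 1%R.
Proof.
unfold Cmod, unit_dn. simpl. transitivity (sqrt 1); [f_equal|apply sqrt_1].
assert (H : (sqrt (1 - x * x) * sqrt (1 - x * x) = 1 - x * x)%R) by (apply sqrt_sqrt; nra).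
rewrite !Rmult_1_r, Rmult_opp_opp, H. ring.
Qed.

Lemma Re_1_minus_unit e z : Cmod e = 1%R -> (Cmod z < 1)%R -> (0 < Re (1 - e * z))%R.
Proof. intros He Hz. apply Re_1_minus. rewrite Cmod_mult, He. lra. Qed.

(** The square root is built from the logarithms of the two linear factors; no
    branch cut is met as their arguments stay in (- PI / 2, PI / 2), and the half
    sum of these arguments stays there too. *)
Definition log_root (z : C) : C := / 2 * (Log (1 - unit_up * z) + Log (1 - unit_dn * z)).
Definition root (z : C) : C := Cexp (log_root z).

Lemma root_sq z : (Cmod z < 1)%R -> root z * root z = 1 + z * z - 2 * z * x.
Proof.
intros Hz. unfold root. rewrite <- Cexp_plus.
replace (log_root z + log_root z) with (Log (1 - unit_up * z) + Log (1 - unit_dn * z)) by (unfold log_root; field).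
rewrite Cexp_plus, !Cexp_Log by (apply Re_1_minus_unit; auto using Cmod_unit_up, Cmod_unit_dn).
transitivity (1 + (unit_up * unit_dn) * (z * z) - (unit_up + unit_dn) * z); [ring|].
rewrite unit_mul, unit_sum. ring.
Qed.

Lemma Re_root z : (0 < Re (root z))%R.
Proof.
assert (Him : (- PI / 2 < Im (log_root z) < PI / 2)%R).
{ pose proof (atan_bound (Im (1 - unit_up * z) / Re (1 - unit_up * z))) as H1.
  pose proof (atan_bound (Im (1 - unit_dn * z) / Re (1 - unit_dn * z))) as H2.
  replace (Im (log_root z)) with (/ 2 * (atan (Im (1 - unit_up * z) / Re (1 - unit_up * z)) + atan (Im (1 - unit_dn * z) / Re (1 - unit_dn * z))))%R.
  - lra.
  - unfold log_root, Log, Cmult, Cplus, Cinv, RtoC, Im at 5. simpl. field. }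
unfold root, Cexp.
replace (Re _) with (exp (Re (log_root z)) * cos (Im (log_root z)))%R
 by (unfold Cmult, RtoC, Re; simpl; ring).
apply Rmult_lt_0_compat; [apply exp_pos|]. apply cos_gt_0; lra.
Qed.

Lemma Csqrt_root z : (Cmod z < 1)%R -> Csqrt (1 + z ^ 2 - 2 * z * x) = root z.
Proof.
intros Hz. apply Csqrt_unique; [|apply Re_root]. rewrite root_sq by exact Hz.
simpl. ring.
Qed.

Definition baseA (z : C) : C := 1 + root z - z.
Definition baseB (z : C) : C := 1 + root z + z.

Lemma Re_baseA z : (Cmod z < 1)%R -> (0 < Re (baseA z))%R.
Proof.
intros Hz. pose proof (Re_root z). pose proof (Re_1_minus z Hz).
unfold baseA, Re in *. simpl in *. lra.
Qed.

Lemma Re_baseB z : (Cmod z < 1)%R -> (0 < Re (baseB z))%R.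
Proof.
intros Hz. pose proof (Re_root z). pose proof (Re_1_minus (- z) ltac:(rewrite Cmod_opp; exact Hz)).
unfold baseB, Re in *. simpl in *. lra.
Qed.

(** With a prime for the derivative in [z], [slopeR] is [- root' / root],
    [slopeA] is [- baseA' / baseA] and [slopeB] is [baseB' / baseB]; for the last two
    see [dlog_baseA] and [dlog_baseB]. *)
Definition slopeR (z : C) : C := / 2 * (unit_up / (1 - unit_up * z) + unit_dn / (1 - unit_dn * z)).
Definition slopeA (z : C) : C := (1 + x) / (root z * baseB z).
Definition slopeB (z : C) : C := (1 - x) / (root z * baseA z).

Lemma root_sq_slopeR z : (Cmod z < 1)%R -> root z * root z * slopeR z = x - z.
Proof.
intros Hz. unfold slopeR.
assert (H1 := Re_pos_neq0 _ (Re_1_minus_unit unit_up z Cmod_unit_up Hz)).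
assert (H2 := Re_pos_neq0 _ (Re_1_minus_unit unit_dn z Cmod_unit_dn Hz)).
rewrite root_sq by exact Hz.
replace (1 + z * z - 2 * z * x) with ((1 - unit_up * z) * (1 - unit_dn * z)).
- replace (_ * _) with (/ 2 * ((unit_up + unit_dn) - 2 * (unit_up * unit_dn) * z)) by (field; auto).
  rewrite unit_mul, unit_sum. field.
- transitivity (1 + (unit_up * unit_dn) * (z * z) - (unit_up + unit_dn) * z); [ring|].
  rewrite unit_mul, unit_sum. ring.
Qed.

Lemma root_neq0 z : root z <> 0.
Proof. apply Cexp_neq0. Qed.

(** The derivative of [baseA] is [- root * slopeR - 1 = - (x - z + root) / root],
    and [x - z + root] is proportional to [baseA / baseB]. *)
Lemma dlog_baseA z : (Cmod z < 1)%R -> (- (root z * slopeR z) - 1) / baseA z = - slopeA z.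
Proof.
intros Hz. pose proof (Re_pos_neq0 _ (Re_baseA z Hz)) as HA. pose proof (Re_pos_neq0 _ (Re_baseB z Hz)) as HB.
pose proof (root_neq0 z) as HR. pose proof (root_sq z Hz) as E. pose proof (root_sq_slopeR z Hz) as E2.
assert (E3 : slopeR z = (x - z) / (root z * root z)) by (rewrite <- E2; field; exact HR).
rewrite E3. unfold slopeA.
(* The two sides differ by [root ^ 2 - (1 + z ^ 2 - 2 z x)]. *)
assert (EP : (x - z + root z) * baseB z = (1 + x) * baseA z).
{ replace ((x - z + root z) * baseB z) with ((1 + x) * baseA z + (root z * root z - (1 + z * z - 2 * z * x))) by (unfold baseA, baseB; ring).
  rewrite E. ring. }
transitivity (- ((x - z + root z) * baseB z) / (root z * baseA z * baseB z)); [field; auto|].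
rewrite EP. field. auto.
Qed.

Lemma dlog_baseB z : (Cmod z < 1)%R -> (- (root z * slopeR z) + 1) / baseB z = slopeB z.
Proof.
intros Hz. pose proof (Re_pos_neq0 _ (Re_baseA z Hz)) as HA. pose proof (Re_pos_neq0 _ (Re_baseB z Hz)) as HB.
pose proof (root_neq0 z) as HR. pose proof (root_sq z Hz) as E. pose proof (root_sq_slopeR z Hz) as E2.
assert (E3 : slopeR z = (x - z) / (root z * root z)) by (rewrite <- E2; field; exact HR).
rewrite E3. unfold slopeB.
assert (EP : (z - x + root z) * baseA z = (1 - x) * baseB z).
{ replace ((z - x + root z) * baseA z) with ((1 - x) * baseB z + (root z * root z - (1 + z * z - 2 * z * x))) by (unfold baseA, baseB; ring).
  rewrite E. ring. }
transitivity (((z - x + root z) * baseA z) / (root z * baseA z * baseB z)); [field; auto|].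
rewrite EP. field. auto.
Qed.

(** Logarithm of [2 ^ (a + b) / (R * A ^ a * B ^ b)]. *)
Definition log_gen_fun (a b : C) (z : C) : C :=
  (a + b) * Log 2 + - a * Log (baseA z) + - b * Log (baseB z) + - (1) * log_root z.

Lemma Cder_Log_1_minus e z t : Cmod e = 1%R -> (Cmod z < 1)%R -> (0 <= t <= 1)%R ->
  Cder (fun t => Log (1 - e * (RtoC t * z))) t (- (z * (e / (1 - e * (t * z))))).
Proof.
intros He Hz Ht. pose proof (Cmod_tz_lt1 t z Hz Ht) as Htz.
pose proof (Re_1_minus_unit e _ He Htz) as HR.
eapply Cder_eq.
- apply (Cder_Log (fun t => 1 - e * (RtoC t * z)) t (0 + - (1) * (e * z))); [|exact HR].
  eapply (Cder_plus (fun _ => 1) (fun t => - (e * (RtoC t * z)))); [apply Cder_const|].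
  assert (H := Cder_scal (- (1)) _ t _ (Cder_scal e _ t _ (Cder_lin z t))).
  eapply Cder_ext, H. intros s. cbv beta. ring.
- field. now apply Re_pos_neq0.
Qed.

Lemma Cder_log_root z t : (Cmod z < 1)%R -> (0 <= t <= 1)%R ->
  Cder (fun t => log_root (RtoC t * z)) t (- (z * slopeR (t * z))).
Proof.
intros Hz Ht. unfold log_root. eapply Cder_eq.
- apply Cder_scal, Cder_plus; apply Cder_Log_1_minus; auto using Cmod_unit_up, Cmod_unit_dn.
- unfold slopeR. ring.
Qed.

Lemma Cder_log_gen_fun a b z t : (Cmod z < 1)%R -> (0 <= t <= 1)%R ->
  Cder (fun t => log_gen_fun a b (RtoC t * z)) t (z * (slopeR (t * z) + a * slopeA (t * z) + - b * slopeB (t * z))).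
Proof.
intros Hz Ht. pose proof (Cmod_tz_lt1 t z Hz Ht) as Htz.
assert (HR := Cder_log_root z t Hz Ht).
assert (HW : Cder (fun t => root (RtoC t * z)) t (- (z * slopeR (t * z)) * root (t * z)))
  by (apply (Cder_Cexp (fun t => log_root (RtoC t * z))), HR).
assert (HA : Cder (fun t => baseA (RtoC t * z)) t (z * (- (root (t * z) * slopeR (t * z)) - 1))).
{ eapply Cder_eq.
  - apply Cder_plus; [apply Cder_plus; [apply Cder_const|exact HW]|].
    eapply Cder_ext, (Cder_scal (- (1)) _ t _ (Cder_lin z t)). intros s. cbv beta. ring.
  - ring. }
assert (HB : Cder (fun t => baseB (RtoC t * z)) t (z * (- (root (t * z) * slopeR (t * z)) + 1))).
{ eapply Cder_eq.
  - apply Cder_plus; [apply Cder_plus; [apply Cder_const|exact HW]|apply Cder_lin].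
  - ring. }
apply Cder_Log in HA; [|now apply Re_baseA]. apply Cder_Log in HB; [|now apply Re_baseB].
eapply Cder_eq.
- unfold log_gen_fun. apply Cder_plus; [apply Cder_plus; [apply Cder_plus|]|].
  + apply Cder_const.
  + apply Cder_scal, HA.
  + apply Cder_scal, HB.
  + apply Cder_scal, HR.
- transitivity (z * (slopeR (t * z) + - a * ((- (root (t * z) * slopeR (t * z)) - 1) / baseA (t * z))
    + - b * ((- (root (t * z) * slopeR (t * z)) + 1) / baseB (t * z)))); [unfold Cdiv; ring|].
  rewrite dlog_baseA, dlog_baseB by exact Htz. ring.
Qed.

Lemma Log_1 : Log 1 = 0.
Proof.
unfold Log. rewrite Cmod_1, ln_1. unfold Re, Im. simpl.
replace (0 / 1)%R with 0%R by field. now rewrite atan_0.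
Qed.

Lemma log_root_0 : log_root 0 = 0.
Proof.
unfold log_root. rewrite !Cmult_0_r. replace (1 - 0) with (RtoC 1) by ring.
rewrite Log_1. ring.
Qed.

Lemma root_0 : root 0 = 1.
Proof. unfold root. rewrite log_root_0. apply Cexp_0. Qed.

Definition inv_root (z : C) : C := Cexp (- (1) * log_root z).

Lemma root_inv_root z : root z * inv_root z = 1.
Proof. unfold root, inv_root. replace (- (1) * log_root z) with (- log_root z) by ring. apply Cexp_opp_r. Qed.

Lemma inv_root_eq z : inv_root z = / root z.
Proof.
pose proof (root_neq0 z) as H. replace (inv_root z) with (/ root z * (root z * inv_root z)) by (field; exact H).
rewrite root_inv_root. ring.
Qed.

Lemma is_sum_geom w : (Cmod w < 1)%R -> is_sum (fun n => w ^ n) (/ (1 - w)).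
Proof.
intros Hw. assert (H : is_sum (fun n => w ^ n) (Csum (fun n => w ^ n))).
{ apply is_sum_of_ex, (ex_sum_geom _ 1 (Cmod w)).
  - split; [apply Cmod_ge_0|exact Hw].
  - intros n. rewrite Cmod_pow. lra. }
set (S := Csum _) in *.
assert (E : S = 1 + w * S).
{ apply (is_sum_unique (fun n => w ^ n)); [exact H|].
  apply (is_sum_cons (fun n => w ^ n)). eapply is_sum_ext, (is_sum_scal w), H. intros n. reflexivity. }
pose proof (Re_pos_neq0 _ (Re_1_minus w Hw)) as Hn.
replace (/ (1 - w)) with S; [exact H|].
replace S with ((S - w * S) * / (1 - w)) by (field; exact Hn).
replace (S - w * S) with (RtoC 1) by (rewrite E at 1; ring). ring.
Qed.

(** Coefficients of [slopeR], the logarithmic derivative of [/ root]. *)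
Definition legendre_logder (n : nat) : C := / 2 * (unit_up ^ S n + unit_dn ^ S n).

Lemma is_sum_legendre_logder z : (Cmod z < 1)%R -> is_sum (fun n => legendre_logder n * z ^ n) (slopeR z).
Proof.
intros Hz. unfold slopeR.
assert (H : forall e, Cmod e = 1%R -> is_sum (fun n => e * (e * z) ^ n) (e / (1 - e * z))).
{ intros e He. apply is_sum_scal, is_sum_geom. rewrite Cmod_mult, He. lra. }
eapply is_sum_ext, is_sum_scal, is_sum_plus; [|apply H, Cmod_unit_up|apply H, Cmod_unit_dn].
intros n. cbv beta. unfold legendre_logder. rewrite !Cpow_mult_l, !Cpow_S. ring.
Qed.

Lemma Cmod_legendre_logder n : (Cmod (legendre_logder n) <= 1)%R.
Proof.
unfold legendre_logder. rewrite Cmod_mult.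
replace (Cmod (/ 2)) with (/ 2)%R.
- pose proof (Cmod_triangle (unit_up ^ S n) (unit_dn ^ S n)) as H.
  rewrite !Cmod_pow, Cmod_unit_up, Cmod_unit_dn, pow1 in H. lra.
- rewrite <- RtoC_inv, Cmod_R, Rabs_pos_eq by lra. reflexivity.
Qed.

(** Coefficients of [/ root], that is, Legendre polynomials at [x]; they are bounded
    by 1 since those of the logarithmic derivative are. *)
Definition legendre : nat -> C := logder_seq legendre_logder.

Lemma is_sum_legendre z : (Cmod z < 1)%R -> is_sum (fun n => legendre n * z ^ n) (inv_root z).
Proof.
intros Hz.
assert (H := logder_sum legendre_logder 1%R Cmod_legendre_logder z (fun t => - (1) * log_root (t * z)) (fun t => slopeR (t * z)) Hz).
cbv beta in H. rewrite !Cmult_0_l, !Cmult_1_l, log_root_0, Cmult_0_r in H.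
apply H.
- intros t Ht. apply is_sum_legendre_logder. now apply Cmod_tz_lt1.
- intros t Ht. eapply Cder_eq; [apply Cder_scal, Cder_log_root; auto|]. ring.
- apply Cexp_0.
Qed.

Lemma Cmod_legendre n : (Cmod (legendre n) <= 1)%R.
Proof.
eapply Rle_trans; [apply (logder_bound legendre_logder 1%R Cmod_legendre_logder)|].
pose proof (rpoch_gt0 1 n Rlt_0_1). right. field. lra.
Qed.

Lemma legendre_0 : legendre 0 = 1.
Proof. reflexivity. Qed.

Lemma legendre_1 : legendre 1 = x.
Proof.
pose proof (logder_seq_rec legendre_logder 0) as H. fold legendre in H. unfold cauchy in H.
rewrite Cplus_0_l, Cmult_1_l in H. rewrite H. simpl. fold legendre. rewrite legendre_0. unfold legendre_logder.
transitivity (/ 2 * (unit_up + unit_dn)); [simpl; ring|]. rewrite unit_sum. field.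
Qed.

(** Coefficients of [slopeR + a * slopeA - b * slopeB], the logarithmic derivative
    of the generating function; the terms in [a] and [b] are explained by
    [is_sum_legendre_shift]. *)
Definition gen_fun_logder (a b : C) (n : nat) : C :=
  legendre_logder n + a / 2 * (legendre (S n) + legendre n) + b / 2 * (legendre (S n) - legendre n).

(** Since [baseB * (1 + z - root) = 2 (1 + x) z], the function [slopeA] equals
    [((1 + z) / root - 1) / (2 z)], whose coefficients are half sums of neighbouring
    Legendre coefficients; [slopeB] is similar. *)
Lemma is_sum_legendre_shift z : (Cmod z < 1)%R -> exists L,
  is_sum (fun n => legendre (S n) * z ^ n) L /\ (L + inv_root z) / 2 = slopeA z /\ (L - inv_root z) / 2 = - slopeB z.
Proof.
intros Hz. pose proof (Re_pos_neq0 _ (Re_baseA z Hz)) as HA. pose proof (Re_pos_neq0 _ (Re_baseB z Hz)) as HB.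
pose proof (root_neq0 z) as HR. rewrite inv_root_eq.
destruct (Ceq_dec z 0) as [->|Hz0].
- exists (RtoC x). split.
  + replace (RtoC x) with (csum (fun n => legendre (S n) * 0 ^ n) 1) by (cbn [csum]; rewrite legendre_1; simpl; ring).
    apply is_sum_finite. intros k Hk. destruct k; [lia|]. rewrite Cpow_S. ring.
  + unfold slopeA, slopeB, baseA, baseB in *. rewrite root_0 in *. split; field.
- exists ((inv_root z - 1) / z). split.
  + assert (H := is_sum_tail _ _ 1 (is_sum_legendre z Hz)).
    apply (is_sum_scal (/ z)) in H.
    replace ((inv_root z - 1) / z) with (/ z * (inv_root z - csum (fun n => legendre n * z ^ n) 1)).
    * eapply is_sum_ext, H. intros n. simpl. field. exact Hz0.
    * simpl. rewrite legendre_0. field. exact Hz0.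
  + rewrite inv_root_eq. pose proof (root_sq z Hz) as E.
    (* Eliminating [x] turns the claim into an identity in [z] and [root z]. *)
    assert (Ex : RtoC x = (1 + z * z - root z * root z) / (2 * z)) by (rewrite E; field; exact Hz0).
    unfold slopeA, slopeB, baseA, baseB in *. rewrite Ex. split; field; auto.
Qed.

Lemma is_sum_gen_fun_logder a b z : (Cmod z < 1)%R ->
  is_sum (fun n => gen_fun_logder a b n * z ^ n) (slopeR z + a * slopeA z + - b * slopeB z).
Proof.
intros Hz. destruct (is_sum_legendre_shift z Hz) as [L [HL [EU EV]]].
assert (Hl := is_sum_legendre z Hz).
replace (slopeR z + a * slopeA z + - b * slopeB z) with
 (slopeR z + (a / 2 * (L + inv_root z) + b / 2 * (L + - (1) * inv_root z))).
- eapply is_sum_ext, (is_sum_plus _ _ _ _ (is_sum_legendre_logder z Hz)), is_sum_plus.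
  2: apply is_sum_scal, is_sum_plus; [exact HL|exact Hl].
  2: apply is_sum_scal, is_sum_plus; [exact HL|apply is_sum_scal, Hl].
  intros n. cbv beta. unfold gen_fun_logder. ring.
- rewrite <- EU. replace (- b * slopeB z) with (b * (- slopeB z)) by ring. rewrite <- EV. field.
Qed.

Lemma Cmod_gen_fun_logder a b n : (Cmod (gen_fun_logder a b n) <= 1 + Cmod a + Cmod b)%R.
Proof.
unfold gen_fun_logder.
assert (H : forall c u, (Cmod u <= 2)%R -> (Cmod (c / 2 * u) <= Cmod c)%R).
{ intros c u Hu. rewrite Cmod_mult. unfold Cdiv. rewrite Cmod_mult.
  replace (Cmod (/ 2)) with (/ 2)%R by (rewrite <- RtoC_inv, Cmod_R, Rabs_pos_eq by lra; reflexivity).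
  pose proof (Cmod_ge_0 c). nra. }
pose proof (Cmod_legendre n). pose proof (Cmod_legendre (S n)).
eapply Rle_trans; [apply Cmod_triangle|]. apply Rplus_le_compat.
- eapply Rle_trans; [apply Cmod_triangle|]. apply Rplus_le_compat; [apply Cmod_legendre_logder|].
  apply H. eapply Rle_trans; [apply Cmod_triangle|]. lra.
- apply H. eapply Rle_trans; [apply Cmod_triangle|]. rewrite Cmod_opp. lra.
Qed.

Definition gen_fun_coef (a b : C) : nat -> C := logder_seq (gen_fun_logder a b).
Definition gen_fun (a b z : C) : C := Cexp (log_gen_fun a b z).

Lemma log_gen_fun_0 a b : log_gen_fun a b 0 = 0.
Proof.
unfold log_gen_fun, baseA, baseB. rewrite root_0, log_root_0.
replace (1 + 1 - 0) with (RtoC 2) by (rewrite <- RtoC_plus, <- RtoC_minus; f_equal; ring).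
replace (1 + 1 + 0) with (RtoC 2) by (rewrite <- !RtoC_plus; f_equal; ring).
ring.
Qed.

Lemma is_sum_gen_fun a b z : (Cmod z < 1)%R -> is_sum (fun n => gen_fun_coef a b n * z ^ n) (gen_fun a b z).
Proof.
intros Hz.
assert (H := logder_sum (gen_fun_logder a b) _ (Cmod_gen_fun_logder a b) z (fun t => log_gen_fun a b (t * z))
  (fun t => slopeR (t * z) + a * slopeA (t * z) + - b * slopeB (t * z)) Hz).
cbv beta in H. rewrite !Cmult_0_l, !Cmult_1_l, log_gen_fun_0 in H.
apply H.
- intros t Ht. apply is_sum_gen_fun_logder. now apply Cmod_tz_lt1.
- intros t Ht. now apply Cder_log_gen_fun.
- apply Cexp_0.
Qed.

Lemma gen_fun_shift_b a b z : (Cmod z < 1)%R -> gen_fun a (b + 1) z = gen_fun a b z * (2 / baseB z).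
Proof.
intros Hz. pose proof (Re_baseB z Hz) as HB. unfold gen_fun.
replace (log_gen_fun a (b + 1) z) with (log_gen_fun a b z + (Log 2 + - Log (baseB z))) by (unfold log_gen_fun; ring).
rewrite !Cexp_plus. f_equal. unfold Cdiv. f_equal.
- apply Cexp_Log. unfold Re. simpl. lra.
- pose proof (Cexp_opp_r (Log (baseB z))) as E. rewrite Cexp_Log in E by exact HB.
  apply Re_pos_neq0 in HB. transitivity (/ baseB z * (baseB z * Cexp (- Log (baseB z)))); [field; exact HB|].
  rewrite E. ring.
Qed.

Lemma gen_fun_shift_a a b z : (Cmod z < 1)%R -> gen_fun (a + 1) b z = gen_fun a b z * (2 / baseA z).
Proof.
intros Hz. pose proof (Re_baseA z Hz) as HB. unfold gen_fun.
replace (log_gen_fun (a + 1) b z) with (log_gen_fun a b z + (Log 2 + - Log (baseA z))) by (unfold log_gen_fun; ring).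
rewrite !Cexp_plus. f_equal. unfold Cdiv. f_equal.
- apply Cexp_Log. unfold Re. simpl. lra.
- pose proof (Cexp_opp_r (Log (baseA z))) as E. rewrite Cexp_Log in E by exact HB.
  apply Re_pos_neq0 in HB. transitivity (/ baseA z * (baseA z * Cexp (- Log (baseA z)))); [field; exact HB|].
  rewrite E. ring.
Qed.

Lemma gen_fun_coef_subexp a b : subexp (fun n => Cmod (gen_fun_coef a b n)).
Proof. apply (logder_subexp _ _ (Cmod_gen_fun_logder a b)). Qed.

Lemma is_sum_gen_fun_derive a b z : (Cmod z < 1)%R ->
  is_sum (fun n => (INR n + 1) * gen_fun_coef a b (S n) * z ^ n)
   (gen_fun a b z * (slopeR z + a * slopeA z + - b * slopeB z)).
Proof.
intros Hz. apply (logder_derivative _ _ (Cmod_gen_fun_logder a b)); auto.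
- now apply is_sum_gen_fun.
- now apply is_sum_gen_fun_logder.
Qed.

(** The operator [z d/dz], which multiplies the coefficients by their index. *)
Lemma is_sum_gen_fun_euler a b z : (Cmod z < 1)%R ->
  is_sum (fun n => INR n * gen_fun_coef a b n * z ^ n)
   (z * (gen_fun a b z * (slopeR z + a * slopeA z + - b * slopeB z))).
Proof.
intros Hz. rewrite <- (Cplus_0_l (z * _)).
replace (RtoC 0) with (INR 0 * gen_fun_coef a b 0 * z ^ 0) at 1 by (simpl; ring).
apply (is_sum_cons (fun n => INR n * gen_fun_coef a b n * z ^ n)).
eapply is_sum_ext, is_sum_scal, is_sum_gen_fun_derive, Hz.
intros n. cbv beta. rewrite Cpow_S, INR_S_C. ring.
Qed.

(** The recurrence [jac_rec] read on generating functions, after division by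
    [gen_fun a b z]: raising [a] or [b] multiplies the generating function by [2 / baseA]
    or [2 / baseB], and each derivative contributes a logarithmic derivative. *)
Lemma gen_fun_identity a b z : (Cmod z < 1)%R ->
  slopeR z + a * slopeA z + - b * slopeB z
  = (1 + x) / 2 * (2 / baseB z * (z * (slopeR z + a * slopeA z + - (b + 1) * slopeB z) + (1 + a)))
    - (1 - x) / 2 * (2 / baseA z * (z * (slopeR z + (a + 1) * slopeA z + - b * slopeB z) + (1 + b))).
Proof.
intros Hz. pose proof (Re_pos_neq0 _ (Re_baseA z Hz)) as HA. pose proof (Re_pos_neq0 _ (Re_baseB z Hz)) as HB.
pose proof (root_neq0 z) as HR.
assert (E3 : slopeR z = (x - z) / (root z * root z)) by (rewrite <- root_sq_slopeR by exact Hz; field; exact HR).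
rewrite E3. clear E3.
(* For [z <> 0], [x] is a rational function of [z] and [root z]. *)
destruct (Ceq_dec z 0) as [->|Hz0].
- unfold slopeA, slopeB, baseA, baseB in *. rewrite root_0 in *. field.
- pose proof (root_sq z Hz) as E.
  assert (Ex : RtoC x = (1 + z * z - root z * root z) / (2 * z)) by (rewrite E; field; exact Hz0).
  unfold slopeA, slopeB, baseA, baseB in *. rewrite Ex. field; auto.
Qed.

Lemma gen_fun_coef_rec n a b :
  (INR n + 1) * gen_fun_coef a b (S n)
  = (INR n + 1 + a) * (1 - (1 - x) / 2) * gen_fun_coef a (b + 1) n - (INR n + 1 + b) * ((1 - x) / 2) * gen_fun_coef (a + 1) b n.
Proof.
set (c := (1 + x) / 2). set (s := (1 - x) / 2).
set (D := fun n => (INR n + 1) * gen_fun_coef a b (S n) + (- c * ((INR n + 1 + a) * gen_fun_coef a (b + 1) n)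
   + s * ((INR n + 1 + b) * gen_fun_coef (a + 1) b n))).
assert (HD : D n = 0).
{ apply coef_zero. intros z Hz.
  replace (RtoC 0) with (gen_fun a b z * (slopeR z + a * slopeA z + - b * slopeB z)
    + (- c * (z * (gen_fun a (b + 1) z * (slopeR z + a * slopeA z + - (b + 1) * slopeB z)) + (1 + a) * gen_fun a (b + 1) z)
      + s * (z * (gen_fun (a + 1) b z * (slopeR z + (a + 1) * slopeA z + - b * slopeB z)) + (1 + b) * gen_fun (a + 1) b z))).
  - eapply is_sum_ext, is_sum_plus; [|apply is_sum_gen_fun_derive, Hz|].
    2: apply is_sum_plus; apply is_sum_scal, is_sum_plus.
    2: apply is_sum_gen_fun_euler, Hz. 2: apply is_sum_scal, is_sum_gen_fun, Hz.
    2: apply is_sum_gen_fun_euler, Hz. 2: apply is_sum_scal, is_sum_gen_fun, Hz.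
    intros m. cbv beta. unfold D. ring.
  - rewrite gen_fun_shift_a, gen_fun_shift_b by exact Hz.
    rewrite (gen_fun_identity a b z Hz). unfold c, s. ring. }
unfold D in HD.
replace (1 - s) with c by (unfold c, s; field).
transitivity (((INR n + 1) * gen_fun_coef a b (S n) +
     (- c * ((INR n + 1 + a) * gen_fun_coef a (b + 1) n) +
      s * ((INR n + 1 + b) * gen_fun_coef (a + 1) b n)))
  + ((INR n + 1 + a) * c * gen_fun_coef a (b + 1) n - (INR n + 1 + b) * s * gen_fun_coef (a + 1) b n)); [ring|].
rewrite HD. ring.
Qed.

Lemma gen_fun_coef_jac n a b : gen_fun_coef a b n = jac n a b ((1 - x) / 2).
Proof.
apply (jac_unique (fun n a b => gen_fun_coef a b n)).
- reflexivity.
- apply gen_fun_coef_rec.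
Qed.

(** Jacobi's generating function. The coefficients of the closed form are not
    computed but recognized by their recurrence. *)
Theorem jac_generating a b z : (Cmod z < 1)%R ->
  is_sum (fun n => jac n a b ((1 - x) / 2) * z ^ n) (gen_fun a b z).
Proof. intros Hz. eapply is_sum_ext, is_sum_gen_fun, Hz. intros n. cbv beta. now rewrite gen_fun_coef_jac. Qed.

(** Cancellation in the explicit sum makes such a bound hard to read off from it;
    here it comes from the convergence of the generating function. *)
Lemma jac_subexp a b : subexp (fun n => Cmod (jac n a b ((1 - x) / 2))).
Proof. eapply subexp_le, (gen_fun_coef_subexp a b). intros n. cbv beta. rewrite <- gen_fun_coef_jac. apply Rle_refl. Qed.
End Gen.

(** * The expansion *)

(** The factor [- n] of the terminating series produces signed binomial
    coefficients. *)
Lemma poch_minus_nat k m :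
  poch (- INR (k + m)) k * INR (fact m) = (- (1)) ^ k * INR (fact (k + m)).
Proof.
revert m. induction k as [|k IH]; intros m; [simpl; ring|].
rewrite poch_S, Cpow_S. replace (S k + m)%nat with (k + S m)%nat by lia.
specialize (IH (S m)). rewrite fact_S_C in IH.
replace (- INR (k + S m) + INR k) with (- (INR m + 1)) by (rewrite INR_add_C, INR_S_C; ring).
transitivity (- (poch (- INR (k + S m)) k * ((INR m + 1) * INR (fact m)))); [ring|].
rewrite IH. ring.
Qed.

(** The hypothesis allows division by [poch (a + 1) j], which the hypergeometric form
    requires. *)
Lemma Jacobi_jac n (a b z : C) : (forall j, a + 1 + INR j <> 0) ->
  Jacobi n a b z = jac n a b ((1 - z) / 2).
Proof.
intros Ha. unfold Jacobi, pFq. set (w := (1 - z) / 2).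
rewrite (is_sum_Csum _ (csum (pFq_term [- INR n; INR n + a + b + 1] [a + 1] w) (S n))).
- unfold jac. rewrite <- csum_scal. apply csum_ext. intros k Hk.
  assert (exists m, n = (k + m)%nat) as [m ->] by (exists (n - k)%nat; lia).
  rewrite jac_coef_add. unfold pFq_term, Cprod. cbn [map fold_right].
  rewrite (poch_add (a + 1)).
  replace (a + 1 + INR k) with (a + INR k + 1) by ring.
  rewrite <- INR_add_C.
  assert (Hp := poch_neq0 _ k Ha).
  assert (H1 := fact_neq0 k). assert (H2 := fact_neq0 m). assert (H3 := fact_neq0 (k + m)).
  replace (poch (- INR (k + m)) k) with ((- (1)) ^ k * INR (fact (k + m)) / INR (fact m))
    by (rewrite <- poch_minus_nat; field; exact H2).
  replace (- w) with (- (1) * w) by ring. rewrite Cpow_mult_l. field. auto.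
- apply is_sum_finite. intros k Hk. unfold pFq_term, Cprod. cbn [map fold_right].
  rewrite poch_eq0 by lia. unfold Cdiv. ring.
Qed.

Lemma pow4_neq0 k : 4 ^ k <> 0.
Proof. apply Cpow_nz. intros H. apply RtoC_inj in H. lra. Qed.

(** The duplication formula turns the two half-argument Pochhammer symbols of
    the expansion into a single one of length [2 * k]. *)
Lemma poch_double z k : poch (z / 2) k * poch ((z + 1) / 2) k = / 4 ^ k * poch z (2 * k).
Proof.
induction k as [|k IH]; [simpl; field|].
replace (2 * S k)%nat with (S (S (2 * k))) by lia.
rewrite !poch_S, INR_S_C, Cpow_S. replace (RtoC (INR (2 * k))) with (2 * INR k)
  by (replace (2 * k)%nat with (k + k)%nat by lia; rewrite INR_add_C; ring).
transitivity ((poch (z / 2) k * poch ((z + 1) / 2) k) * ((z / 2 + INR k) * ((z + 1) / 2 + INR k))); [ring|].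
assert (H4 := pow4_neq0 k).
rewrite IH. field. exact H4.
Qed.

Lemma poch_R (a : R) n : poch a n = rpoch a n.
Proof. induction n as [|n IH]; simpl; [reflexivity|]. now rewrite IH, RtoC_mult, RtoC_plus. Qed.

Lemma rpoch_add a m n : rpoch a (m + n) = (rpoch a m * rpoch (a + INR m) n)%R.
Proof.
induction n as [|n IH]; simpl; [rewrite Nat.add_0_r; ring|].
rewrite Nat.add_succ_r. simpl. rewrite IH, plus_INR. ring.
Qed.

Lemma Cmod_poch z (a : R) n : (Cmod z <= a)%R -> (Cmod (poch z n) <= rpoch a n)%R.
Proof.
intros H. induction n as [|n IH]; simpl.
- rewrite Cmod_1. lra.
- rewrite Cmod_mult. apply Rmult_le_compat; auto using Cmod_ge_0.
  eapply Rle_trans; [apply Cmod_triangle|].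
  rewrite Cmod_R, Rabs_pos_eq by apply pos_INR. lra.
Qed.

(** The exponent 5 is the total number of factors [r ^ (k + n)] lost in
    [double_term_bound]. *)
Lemma ex_dilation u : (0 <= u < 1)%R -> exists r, (1 < r /\ r ^ 5 * u < 1)%R.
Proof.
(* [31 = 2 ^ 5 - 1]: for [h <= 1] convexity gives [(1 + h) ^ 5 <= 1 + 31 * h]. *)
intros Hu. set (h := ((1 - u) / 31)%R). exists (1 + h)%R.
assert (Hh : (0 < h <= 1)%R) by (unfold h; lra).
split; [lra|].
assert ((1 + h) ^ 5 <= 1 + 31 * h)%R.
{ assert (h * h <= h)%R by nra. assert (h * h * h <= h)%R by nra.
  assert (h * h * h * h <= h)%R by nra. assert (h * h * h * h * h <= h)%R by nra.
  simpl. nra. }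
assert (1 + 31 * h = 2 - u)%R by (unfold h; field).
nra.
Qed.

Section Main.
Variables (al : C) (be ga : R) (x : R).
Hypothesis Hbe : (-1 < be)%R.
Hypothesis Hga : (-1 < ga)%R.
Hypothesis Hsne : (be + ga + 1 <> 0)%R.
Hypothesis hx : (-1 <= x <= 1)%R.

Let s : R := (ga + be + 1)%R.

Lemma s_shift_neq0 i : (s + INR i <> 0)%R.
Proof.
destruct i as [|i]; [simpl; unfold s; lra|]. rewrite S_INR. pose proof (pos_INR i).
unfold s. lra.
Qed.

Lemma s_C : RtoC s = ga + be + 1.
Proof. unfold s. now rewrite !RtoC_plus. Qed.

Lemma s_shift_neq0_C i : ga + be + 1 + INR i <> 0.
Proof. rewrite <- s_C, <- RtoC_plus. intros H. apply RtoC_inj in H. now apply s_shift_neq0 in H. Qed.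

Lemma s_neq0_C : RtoC s <> 0.
Proof. intros H. apply RtoC_inj in H. unfold s in H. lra. Qed.

Lemma lower_poch_neq0 k n : poch (ga + be + 2 * INR k + 2) n <> 0.
Proof.
apply poch_neq0. intros j.
replace (ga + be + 2 * INR k + 2 + INR j) with (RtoC (ga + be + 1 + INR (S (k + k + j)))).
- intros H. apply RtoC_inj in H. now apply (s_shift_neq0 (S (k + k + j))).
- rewrite !RtoC_plus, INR_S_C, !INR_add_C. ring.
Qed.

(** Every Pochhammer symbol is completed to one that starts at a fixed point; they
    then pair up into the quotients of [rpoch_ratio_subexp], at the indices
    [k + n], [2 * k + n] and [n], and only the quotient depending on [k] is left. *)
Lemma continued_term_bound (r : R) : (1 < r)%R -> exists K, (0 <= K)%R /\ forall rho k n,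
  (Cmod (continued_term al be ga rho k n) <=
   rpoch (s + 1) (2 * k) / rpoch (be + 1) k * (K * r ^ (3 * (k + n))) * Cmod rho ^ n)%R.
Proof.
intros Hr.
set (A := (Cmod (al + be) + 1)%R). set (D := Cmod (al - ga)).
assert (HA : (0 < A)%R) by (unfold A; pose proof (Cmod_ge_0 (al + be)); lra).
assert (HD : (0 <= D)%R) by apply Cmod_ge_0.
assert (Hs1 : (0 < s + 1)%R) by (unfold s; lra).
assert (Hb1 : (0 < be + 1)%R) by lra.
destruct (rpoch_ratio_subexp (be + 1) A ltac:(lra) HA r Hr) as [K1 [HK1 H1]].
destruct (rpoch_ratio_subexp A (s + 1) ltac:(lra) Hs1 r Hr) as [K2 [HK2 H2]].
destruct (rpoch_ratio_subexp D 1 HD ltac:(lra) r Hr) as [K3 [HK3 H3]].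
exists (K1 * K2 * K3)%R. split; [apply Rmult_le_pos; [apply Rmult_le_pos|]; assumption|].
intros rho k n.
assert (Pb := fun n => rpoch_gt0 (be + 1) n Hb1).
assert (PA := fun n => rpoch_gt0 A n HA).
assert (Ps := fun n => rpoch_gt0 (s + 1) n Hs1).
assert (P1 := fun n => rpoch_gt0 1 n Rlt_0_1).
assert (PD := fun n => rpoch_ge0 D n HD).
assert (Hrho : (0 <= Cmod rho ^ n)%R) by (apply pow_le, Cmod_ge_0).
assert (E : (Cmod (continued_term al be ga rho k n) <=
  rpoch (s + 1) (2 * k) / rpoch (be + 1) k * (rpoch (be + 1) (k + n) / rpoch A (k + n)
   * (rpoch A (2 * k + n) / rpoch (s + 1) (2 * k + n)) * (rpoch D n / rpoch 1 n)) * Cmod rho ^ n)%R).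
{ unfold continued_term.
  replace (be + INR k + 1) with (RtoC (be + 1 + INR k)) by (rewrite !RtoC_plus; ring).
  replace (ga + be + 2 * INR k + 2) with (RtoC (s + 1 + INR (2 * k))).
  2:{ rewrite !RtoC_plus, s_C. replace (2 * k)%nat with (k + k)%nat by lia. rewrite INR_add_C. ring. }
  rewrite !poch_R.
  rewrite (rpoch_add (be + 1) k n).
  replace (2 * k + n)%nat with (k + n + k)%nat at 1 by lia.
  rewrite (rpoch_add A (k + n) k), (rpoch_add (s + 1) (2 * k) n).
  unfold Cdiv. rewrite !Cmod_mult, Cmod_pow.
  assert (Q1 : (0 < rpoch (be + 1 + INR k) n)%R) by (apply rpoch_gt0; pose proof (pos_INR k); lra).
  assert (Q2 : (0 < rpoch (s + 1 + INR (2 * k)) n)%R) by (apply rpoch_gt0; pose proof (pos_INR (2 * k)); lra).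
  rewrite <- !RtoC_inv, !Cmod_R, !Rabs_pos_eq; try (left; first [assumption | apply Rinv_0_lt_compat; assumption | apply Rinv_0_lt_compat, INR_fact_lt_0]).
  rewrite rpoch_1.
  assert (B1 : (Cmod (poch (al - ga) n) <= rpoch D n)%R) by (apply Cmod_poch; right; reflexivity).
  assert (B2 : (Cmod (poch (al + be + INR k + INR n + 1) k) <= rpoch (A + INR (k + n)) k)%R).
  { apply Cmod_poch. replace (al + be + INR k + INR n + 1) with ((al + be) + RtoC (INR (k + n) + 1))
      by (rewrite RtoC_plus, INR_add_C; ring).
    eapply Rle_trans; [apply Cmod_triangle|]. pose proof (pos_INR (k + n)).
    rewrite Cmod_R, Rabs_pos_eq by lra. unfold A. lra. }
  specialize (Pb k). specialize (Ps (2 * k)%nat). specialize (PA (k + n)%nat).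
  pose proof (INR_fact_lt_0 n) as Hf.
  match goal with |- (?l <= ?rr)%R => replace rr with
    (rpoch (be + 1 + INR k) n * rpoch D n * rpoch (A + INR (k + n)) k
      * / rpoch (s + 1 + INR (2 * k)) n * (Cmod rho ^ n * / INR (fact n)))%R end.
  2:{ field. repeat split; lra. }
  apply Rmult_le_compat_r; [apply Rmult_le_pos; [exact Hrho|left; now apply Rinv_0_lt_compat]|].
  apply Rmult_le_compat_r; [left; now apply Rinv_0_lt_compat|].
  apply Rmult_le_compat; auto using Cmod_ge_0.
  - apply Rmult_le_pos; [lra|apply Cmod_ge_0].
  - apply Rmult_le_compat_l; [lra|exact B1].
  - apply INR_fact_neq_0.
  - lra. }
eapply Rle_trans; [exact E|]. apply Rmult_le_compat_r; [exact Hrho|].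
apply Rmult_le_compat_l.
{ apply Rmult_le_pos; [left; apply Ps|left; apply Rinv_0_lt_compat, Pb]. }
replace (K1 * K2 * K3 * r ^ (3 * (k + n)))%R with
  (K1 * r ^ (k + n) * (K2 * r ^ (2 * k + n)) * (K3 * r ^ n))%R.
2:{ replace (3 * (k + n))%nat with ((k + n) + (2 * k + n) + n)%nat by lia. rewrite !pow_add. ring. }
assert (Hq : forall a b, (0 <= a)%R -> (0 < b)%R -> (0 <= a / b)%R).
{ intros a b Ha Hb. apply Rmult_le_pos; [exact Ha|left; now apply Rinv_0_lt_compat]. }
apply Rmult_le_compat; auto.
- apply Rmult_le_pos; apply Hq; auto; left; auto.
- apply Rmult_le_compat; auto; apply Hq; auto; left; auto.
Qed.

Lemma ex_continued rho k : (Cmod rho < 1)%R -> ex_Cseries (continued_term al be ga rho k).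
Proof.
intros Hrho. pose proof (Cmod_ge_0 rho) as H0.
destruct (ex_dilation (Cmod rho) ltac:(lra)) as [r [Hr Hr5]].
destruct (continued_term_bound r Hr) as [K [HK H]].
apply (ex_sum_geom _ (rpoch (s + 1) (2 * k) / rpoch (be + 1) k * (K * r ^ (3 * k))) (r ^ 3 * Cmod rho)).
- split.
  + apply Rmult_le_pos; [apply pow_le; lra|exact H0].
  + eapply Rle_lt_trans, Hr5. apply Rmult_le_compat_r; [exact H0|]. apply Rle_pow; [lra|lia].
- intros n. eapply Rle_trans; [apply H|]. right.
  rewrite Rpow_mult_distr, <- pow_mult.
  replace (3 * (k + n))%nat with (3 * k + 3 * n)%nat by lia. rewrite pow_add. ring.
Qed.

(** Summed over [n] this gives the expansion term of index [k], up to the factor [s];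
    on the antidiagonal [k + n = N] it gives the term of the generating function. *)
Definition double_term (rho : C) (k n : nat) : C :=
  connection_coef al be ga k n * jac k ga be ((1 - x) / 2) * rho ^ (k + n).

(** The quotient of [connection_coef al be ga k n * rho ^ n] by
    [continued_term al be ga rho k n]. *)
Definition row_factor (k : nat) : C := (2 * INR k + s) * poch s k / (s * poch (s + 1)%R (2 * k)).

Lemma poch_s1_neq0 n : poch (s + 1)%R n <> 0.
Proof.
apply poch_neq0. intros j. rewrite <- RtoC_plus. intros H. apply RtoC_inj in H.
apply (s_shift_neq0 (S j)). rewrite S_INR. lra.
Qed.

Lemma double_term_row rho k n :
  double_term rho k n = (row_factor k * jac k ga be ((1 - x) / 2) * rho ^ k) * continued_term al be ga rho k n.
Proof.
unfold double_term, row_factor, connection_coef, continued_term. rewrite <- s_C, Cpow_add_r.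
rewrite Nat.add_1_r, poch_head, poch_add.
replace (s + 1 + INR (2 * k)) with (ga + be + 2 * INR k + 2).
2:{ rewrite s_C. replace (2 * k)%nat with (k + k)%nat by lia. rewrite INR_add_C. ring. }
rewrite RtoC_plus.
assert (H1 := s_neq0_C). assert (H2 := poch_s1_neq0 (2 * k)). rewrite RtoC_plus in H2.
assert (H3 := lower_poch_neq0 k n).
field. repeat split; auto using fact_neq0.
Qed.

(** [poch s k] is [s * poch (s + 1) (k - 1)] for positive [k], which cancels the
    denominator [s]; the bound is thus insensitive to [s] being close to 0. *)
Lemma Cmod_row_factor k :
  (Cmod (row_factor k) <= (2 + / (s + 1)) * (rpoch (s + 1) k / rpoch (s + 1) (2 * k)))%R.
Proof.
assert (Hs1 : (0 < s + 1)%R) by (unfold s; lra).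
assert (Ps := fun n => rpoch_gt0 (s + 1) n Hs1).
assert (Hi : (0 < / (s + 1))%R) by now apply Rinv_0_lt_compat.
unfold row_factor. destruct k as [|k].
- simpl. replace ((2 * 0 + s) * 1 / (s * 1)) with (RtoC 1) by (field; apply s_neq0_C).
  rewrite Cmod_1. unfold Rdiv. rewrite Rinv_1. lra.
- rewrite poch_head, <- RtoC_plus, !poch_R.
  replace (_ / _) with (RtoC ((2 * INR (S k) + s) * rpoch (s + 1) k / rpoch (s + 1) (2 * S k))).
  2:{ assert (Hp := Ps (2 * S k)%nat). rewrite RtoC_div by lra. rewrite !RtoC_mult, RtoC_plus, RtoC_mult. field. split; [|apply s_neq0_C].
      intros H. apply RtoC_inj in H. lra. }
  pose proof (pos_INR k) as Hk.
  assert (P1 := Ps k). assert (P2 := Ps (2 * S k)%nat).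
  rewrite Cmod_R, Rabs_pos_eq.
  2:{ apply Rmult_le_pos; [|left; now apply Rinv_0_lt_compat].
      apply Rmult_le_pos; [rewrite S_INR; lra|lra]. }
  change (rpoch (s + 1) (S k)) with (rpoch (s + 1) k * (s + 1 + INR k))%R.
  unfold Rdiv. rewrite <- Rmult_assoc.
  apply Rmult_le_compat_r; [left; now apply Rinv_0_lt_compat|].
  rewrite (Rmult_comm (rpoch (s + 1) k)), <- Rmult_assoc. apply Rmult_le_compat_r; [lra|].
  rewrite S_INR.
  assert (1 <= / (s + 1) * (s + 1 + INR k))%R.
  { rewrite Rmult_plus_distr_l, Rinv_l by lra.
    assert (0 <= / (s + 1) * INR k)%R by (apply Rmult_le_pos; lra). lra. }
  lra.
Qed.

Lemma double_term_bound rho : (Cmod rho < 1)%R -> exists K q, (0 <= q < 1)%R /\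
  forall k n, (Cmod (double_term rho k n) <= K * q ^ (k + n))%R.
Proof.
intros Hrho. pose proof (Cmod_ge_0 rho) as H0.
destruct (ex_dilation (Cmod rho) ltac:(lra)) as [r [Hr Hr5]].
destruct (continued_term_bound r Hr) as [K [HK H]].
assert (Hs1 : (0 < s + 1)%R) by (unfold s; lra).
assert (Hb1 : (0 < be + 1)%R) by lra.
destruct (rpoch_ratio_subexp (s + 1) (be + 1) ltac:(lra) Hb1 r Hr) as [K1 [HK1 H1]].
destruct (jac_subexp x hx ga be r Hr) as [K2 [HK2 H2]].
assert (Pb := fun n => rpoch_gt0 (be + 1) n Hb1).
assert (Ps := fun n => rpoch_gt0 (s + 1) n Hs1).
exists ((2 + / (s + 1)) * K1 * K2 * K)%R, (r ^ 5 * Cmod rho)%R.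
split.
{ split; [apply Rmult_le_pos; [apply pow_le; lra|exact H0]|exact Hr5]. }
intros k n. rewrite double_term_row, !Cmod_mult, Cmod_pow.
assert (Hi : (0 < / (s + 1))%R) by now apply Rinv_0_lt_compat.
assert (Hrp : forall m, (1 <= r ^ m)%R) by (intros m; apply pow_R1_Rle; lra).
eapply Rle_trans.
{ apply Rmult_le_compat; [| |apply Rmult_le_compat_r; [apply pow_le, H0|]|apply H].
  - repeat apply Rmult_le_pos; try apply Cmod_ge_0. apply pow_le, H0.
  - apply Cmod_ge_0.
  - apply Rmult_le_compat; [apply Cmod_ge_0|apply Cmod_ge_0|apply Cmod_row_factor|apply H2]. }
specialize (H1 k). specialize (Ps (2 * k)%nat) as Ps2. specialize (Ps k). specialize (Pb k).
rewrite Rpow_mult_distr, (pow_add (Cmod rho)), <- pow_mult.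
replace (_ * _)%R with ((rpoch (s + 1) k / rpoch (be + 1) k) *
  ((2 + / (s + 1)) * K2 * K * (r ^ k * r ^ (3 * (k + n))) * (Cmod rho ^ k * Cmod rho ^ n)))%R
  by (field; lra).
replace ((2 + / (s + 1)) * K1 * K2 * K * (r ^ (5 * (k + n)) * (Cmod rho ^ k * Cmod rho ^ n)))%R
 with (K1 * r ^ k * ((2 + / (s + 1)) * K2 * K * (r ^ k * r ^ (3 * (k + n)) * r ^ (n + n)) * (Cmod rho ^ k * Cmod rho ^ n)))%R.
2:{ replace (5 * (k + n))%nat with (k + k + 3 * (k + n) + (n + n))%nat by lia. rewrite !pow_add. ring. }
assert (Hc : (0 <= (2 + / (s + 1)) * K2 * K)%R) by (apply Rmult_le_pos; [apply Rmult_le_pos|]; lra).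
assert (Hd : (0 <= Cmod rho ^ k * Cmod rho ^ n)%R) by (apply Rmult_le_pos; apply pow_le, H0).
assert (He : (0 <= r ^ k * r ^ (3 * (k + n)))%R) by (apply Rmult_le_pos; apply pow_le; lra).
apply Rmult_le_compat; [| |exact H1|].
- apply Rmult_le_pos; [lra|left; now apply Rinv_0_lt_compat].
- apply Rmult_le_pos; [apply Rmult_le_pos|]; assumption.
- apply Rmult_le_compat_r; [exact Hd|]. apply Rmult_le_compat_l; [exact Hc|].
  specialize (Hrp (n + n)%nat). nra.
Qed.

(** For [a = al + be + 1], the quotient [(a + 2k)_n / (a + k)_n] equals
    [(a + k + n)_k] up to a factor independent of [n], which the outer Pochhammer
    symbols cancel. This is why the product extends to exceptional [al]. *)
Lemma pFq_term_continued k n rho : ~ exceptional al be ->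
  pFq_term (F_upper al be ga k) (F_lower al be ga k) rho n
  = poch (al + be + 1) k / poch (al + be + 1) (2 * k) * continued_term al be ga rho k n.
Proof.
intros Hne. set (a := al + be + 1).
assert (Ha : forall j, a + INR j <> 0).
{ intros j Hj. apply Hne. exists j. fold a.
  replace a with (a + INR j + - INR j) by ring. rewrite Hj. ring. }
unfold pFq_term, F_upper, F_lower, continued_term, Cprod. cbn [map fold_right].
assert (Hak : forall m j, a + INR m + INR j <> 0).
{ intros m j. rewrite <- Cplus_assoc, <- INR_add_C. apply Ha. }
assert (H1 := poch_neq0 _ k Ha). assert (H2 := poch_neq0 _ (2 * k) Ha).
assert (H3 := poch_neq0 _ n (Hak k)).
assert (H4 := lower_poch_neq0 k n).
replace (al + be + INR k + 1) with (a + INR k) by (unfold a; ring).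
replace (al + be + INR k + INR n + 1) with (a + INR (k + n)) by (unfold a; rewrite INR_add_C; ring).
replace (al + be + 2 * INR k + 1) with (a + INR (2 * k)).
2:{ unfold a. replace (2 * k)%nat with (k + k)%nat by lia. rewrite INR_add_C. ring. }
assert (E : poch a (2 * k) * poch (a + INR (2 * k)) n = poch a k * poch (a + INR k) n * poch (a + INR (k + n)) k).
{ rewrite <- !poch_add. f_equal. lia. }
replace (poch (a + INR (2 * k)) n) with (poch a k * poch (a + INR k) n * poch (a + INR (k + n)) k / poch a (2 * k))
  by (rewrite <- E; field; exact H2).
field. repeat split; auto using fact_neq0.
Qed.

Lemma coeff_eq rho k : (Cmod rho < 1)%R ->
  coeff al be ga rho k = / 4 ^ k * Csum (continued_term al be ga rho k).
Proof.
intros Hrho. unfold coeff. destruct (excluded_middle_informative _) as [He|Hne]; [reflexivity|].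
assert (H := is_sum_of_ex _ (ex_continued rho k Hrho)).
apply (is_sum_scal (poch (al + be + 1) k / poch (al + be + 1) (2 * k))) in H.
unfold pFq. rewrite (is_sum_Csum _ _ (is_sum_ext _ _ _ (fun n => eq_sym (pFq_term_continued k n rho Hne)) H)).
replace (al + be + 2) with (al + be + 1 + 1).
2:{ ring. }
rewrite poch_double.
assert (Ha : forall j, al + be + 1 + INR j <> 0).
{ intros j Hj. apply Hne. exists j.
  replace (al + be + 1) with (al + be + 1 + INR j + - INR j) by ring. rewrite Hj. ring. }
field. repeat split; try (apply poch_neq0, Ha).
apply pow4_neq0.
Qed.

Lemma expansion_eq rho k : (Cmod rho < 1)%R ->
  expansion_term al be ga rho x k
  = s * ((row_factor k * jac k ga be ((1 - x) / 2) * rho ^ k) * Csum (continued_term al be ga rho k)).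
Proof.
intros Hrho. unfold expansion_term, row_factor. rewrite coeff_eq by exact Hrho.
rewrite Jacobi_jac.
2:{ intros j. rewrite <- !RtoC_plus. intros H. apply RtoC_inj in H. pose proof (pos_INR j). lra. }
replace (ga + be + 3) with (ga + be + 2 + 1).
2:{ ring. }
rewrite poch_double.
replace (ga + be + 2) with (RtoC (s + 1)).
2:{ rewrite RtoC_plus, s_C. ring. }
replace (2 * INR k + ga + be + 1) with (2 * INR k + s) by (rewrite s_C; ring).
rewrite <- s_C. assert (H1 := s_neq0_C). assert (H2 := poch_s1_neq0 (2 * k)).
field. repeat split; auto.
apply pow4_neq0.
Qed.

(** The connection formula makes the antidiagonals of [double_term] add up to the
    generating function, and geometric domination allows summation by rows. *)
Lemma is_sum_expansion rho : (Cmod rho < 1)%R ->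
  is_sum (expansion_term al be ga rho x) (s * gen_fun x al be rho).
Proof.
intros Hrho. destruct (double_term_bound rho Hrho) as [K [q [Hq Hd]]].
set (row := fun k => (row_factor k * jac k ga be ((1 - x) / 2) * rho ^ k) * Csum (continued_term al be ga rho k)).
assert (Hrow : forall k, is_sum (double_term rho k) (row k)).
{ intros k. eapply is_sum_ext, is_sum_scal, is_sum_of_ex, (ex_continued rho k Hrho).
  intros n. symmetry. apply double_term_row. }
apply (is_sum_ext (fun k => s * row k)).
{ intros k. symmetry. now apply expansion_eq. }
apply is_sum_scal, (sum_by_rows_iff (double_term rho) row K q Hq Hd Hrow).
eapply is_sum_ext, (jac_generating x hx al be rho Hrho).
intros N. cbv beta. rewrite (jac_connection al be ga) by apply s_shift_neq0_C.
rewrite Cmult_comm, <- csum_scal. apply csum_ext. intros k Hk. unfold double_term.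
replace (k + (N - k))%nat with N by lia. ring.
Qed.

Lemma closed_form_gen_fun rho : (Cmod rho < 1)%R ->
  Cpower 2 (al + be) / (root x rho * Cpower (1 + root x rho - rho) al * Cpower (1 + root x rho + rho) be)
  = gen_fun x al be rho.
Proof.
intros Hrho. assert (HA := Re_baseA x rho Hrho). assert (HB := Re_baseB x rho Hrho).
unfold baseA, baseB in *.
rewrite !Cpower_Log by (try assumption; unfold Re; simpl; lra).
unfold gen_fun, log_gen_fun. fold (baseA x rho) (baseB x rho). rewrite !Cexp_plus.
fold (inv_root x rho). rewrite inv_root_eq.
replace (- al * Log (baseA x rho)) with (- (al * Log (baseA x rho))) by ring.
replace (- be * Log (baseB x rho)) with (- (be * Log (baseB x rho))) by ring.
assert (HI : forall u, Cexp (- u) = / Cexp u).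
{ intros u. pose proof (Cexp_neq0 u) as Hu.
  transitivity (/ Cexp u * (Cexp u * Cexp (- u))); [field; exact Hu|]. rewrite Cexp_opp_r. ring. }
rewrite !HI. field. repeat split; try apply Cexp_neq0.
Qed.
End Main.

Theorem theorem1 (alpha : C) (beta gamma : R) (rho : C) (x : R)
  (hbeta : (-1 < beta)%R) (hgamma : (-1 < gamma)%R)
  (hbg : (-1 < beta < 0)%R -> (-1 < gamma < 0)%R -> (beta + gamma + 1)%R <> 0%R)
  (hrho : (Cmod rho < 1)%R) (hx : (-1 <= x <= 1)%R) :
  let R := Csqrt (1 + rho ^ 2 - 2 * rho * x) in
  (exceptional alpha beta ->
     forall k : nat, ex_Cseries (continued_term alpha beta gamma rho k)) /\
  (~ exceptional alpha beta ->
     forall k : nat, ex_Cseries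
       (pFq_term (F_upper alpha beta gamma k) (F_lower alpha beta gamma k) rho)) /\
  ex_Cseries (expansion_term alpha beta gamma rho x) /\
  Cpower 2 (alpha + beta)
    / (R * Cpower (1 + R - rho) alpha * Cpower (1 + R + rho) beta)
  = 1 / (gamma + beta + 1) * Csum (expansion_term alpha beta gamma rho x).
Proof.
assert (Hs : (beta + gamma + 1 <> 0)%R).
{ destruct (Rlt_or_le beta 0) as [Hb|Hb]; [|lra].
  destruct (Rlt_or_le gamma 0) as [Hg|Hg]; [|lra]. apply hbg; lra. }
intros R. unfold R. rewrite (Csqrt_root x hx rho hrho).
assert (HS := is_sum_expansion alpha beta gamma x hbeta hgamma Hs hx rho hrho).
repeat split.
- intros _ k. now apply ex_continued.
- intros Hne k.
  assert (H := is_sum_of_ex _ (ex_continued alpha beta gamma hbeta hgamma Hs rho k hrho)).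
  eexists. eapply is_sum_ext, is_sum_scal, H.
  intros n. symmetry. now apply pFq_term_continued.
- eexists. exact HS.
- rewrite closed_form_gen_fun, (is_sum_Csum _ _ HS) by assumption.
  rewrite s_C. field. rewrite <- s_C. now apply s_neq0_C.
Qed.
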